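(* Let $[X,d,m]$ be a metric random walk space with invariant and reversible probability measure $\nu$, assume $\Theta_m<\infty$ and that $\int_X d(x,x_0)\,d\nu(x)<\infty$ for some $x_0\in X$. Let $K>0$. If $$W_1^d(\mu,\nu)\le\frac1K\sqrt{I_\nu(\mu)}\qquad\text{for all probability measures }\mu\ll\nu,$$ then $$W_1^d(\mu,\nu)\le\sqrt{\frac{\sqrt{2\Theta_m}}{K}\,{\rm Ent}_\nu(\mu)}\qquad\text{for all probability measures }\mu\ll\nu.$$
   Context: A metric random walk space $[X,d,m]$ is a Polish metric space $(X,d)$ with a family $m=(m_x)_{x\in X}$ of Borel probability measures, $x\mapsto m_x(A)$ Borel measurable, each with finite first moment. A Radon measure $\nu$ is invariant if $\nu(A)=\int_X m_x(A)d\nu(x)$ for all $\nu$-measurable $A$, reversible if $dm_x(y)d\nu(x)=dm_y(x)d\nu(y)$. $\Theta_m=\operatorname{ess\,sup}_{x\in X}\frac12\int_X d(x,y)^2dm_x(y)$. $W_1^d$ is the $1$-Wasserstein distance. $\mathcal H_m(f)=\frac12\iint(f(y)-f(x))^2dm_x(y)d\nu(x)$; $I_\nu(\mu)=2\mathcal H_m(\sqrt f)$ if $\mu=f\nu$, $f\ge0$, and $+\infty$ otherwise. Relative entropy: ${\rm Ent}_\nu(\mu)=\int_X f\log f\,d\nu-\nu(f)\log\nu(f)$ if $\mu=f\nu$, $f\ge0$, $f\log f\in L^1(X,\nu)$ (with $0\log0=0$, $\nu(f)=\int f d\nu$), and $+\infty$ otherwise. *)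

(* Defs.v *)
From HB Require Import structures.
From mathcomp Require Import all_boot all_order all_algebra.
From mathcomp Require Import all_classical all_reals all_analysis ess_sup_inf.
Set Implicit Arguments. Unset Strict Implicit. Unset Printing Implicit Defensive.
Import Order.TTheory GRing.Theory Num.Def Num.Theory.
Import numFieldNormedType.Exports.
Local Open Scope classical_set_scope.
Local Open Scope ring_scope.
Local Open Scope ereal_scope.

Section mrws.
Context {R : realType} {T : Type}.
Variable dist : T -> T -> R.

Definition is_metric : Prop :=
  (forall x y, dist x y = 0%R <-> x = y) /\
  (forall x y, dist x y = dist y x) /\
  (forall x y z, (dist x z <= dist x y + dist y z)%R).

Definition dopen (A : set T) : Prop :=
  forall x, A x -> exists2 r : R, (0 < r)%R & [set y | (dist x y < r)%R] `<=` A.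

Definition dcomplete : Prop :=
  forall u : nat -> T,
    (forall e : R, (0 < e)%R -> exists N, forall n k, (N <= n)%N -> (N <= k)%N ->
        (dist (u n) (u k) < e)%R) ->
    exists l, forall e : R, (0 < e)%R -> exists N, forall n, (N <= n)%N ->
        (dist (u n) l < e)%R.

Definition dseparable : Prop :=
  exists D : set T, countable D /\
    forall x (e : R), (0 < e)%R -> exists2 y, D y & (dist x y < e)%R.

Definition polish_metric : Prop := [/\ is_metric, dcomplete & dseparable].
End mrws.

Section mrws_meas.
Context {R : realType} {d : measure_display} {X : measurableType d}.
Variable dist : X -> X -> R.

Definition borel_of_metric : Prop :=
  forall A : set X, measurable A <-> <<s dopen dist >> A.

(* reversibility: dm_x(y)dnu(x) = dm_y(x)dnu(y) as measures on X x X *)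
Definition reversible_measure (m : R.-pker X ~> X) (nu : {measure set X -> \bar R}) : Prop :=
  forall C : set (X * X)%type, measurable C ->
    \int[nu]_x m x [set y | C (x, y)] = \int[nu]_y m y [set x | C (x, y)].

Definition invariant_measure (m : R.-pker X ~> X) (nu : {measure set X -> \bar R}) : Prop :=
  forall A : set X, measurable A -> nu A = \int[nu]_x m x A.

Definition Theta (m : R.-pker X ~> X) (nu : {measure set X -> \bar R}) : \bar R :=
  ess_sup nu (fun x => (2^-1)%:E * \int[m x]_y ((dist x y) ^+ 2)%:E).

Definition coupling (mu nu : probability X R) (pi : probability (X * X)%type R) : Prop :=
  forall A : set X, measurable A ->
    pi (A `*` setT) = mu A /\ pi (setT `*` A) = nu A.

Definition W1 (mu nu : probability X R) : \bar R :=
  ereal_inf [set \int[pi]_z (dist z.1 z.2)%:E | pi in coupling mu nu].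

Definition density (nu : {measure set X -> \bar R}) (mu : probability X R)
    (f : X -> R) : Prop :=
  [/\ measurable_fun setT f, (forall x, (0 <= f x)%R) &
      forall A, measurable A -> mu A = \int[nu]_(x in A) (f x)%:E].

Definition Hm (m : R.-pker X ~> X) (nu : {measure set X -> \bar R})
    (g : X -> R) : \bar R :=
  (2^-1)%:E * \int[nu]_x \int[m x]_y ((g y - g x) ^+ 2)%:E.

Definition Inu (m : R.-pker X ~> X) (nu : {measure set X -> \bar R})
    (mu : probability X R) : \bar R :=
  match pselect (exists f, density nu mu f) with
  | left H => 2%:E * Hm m nu (fun x => Num.sqrt (projT1 (cid H) x))
  | right _ => +oo
  end.

(* relative entropy; note ln 0 = 0 in mathcomp, so 0 log 0 = 0 *)
Definition Ent (nu : {measure set X -> \bar R}) (mu : probability X R) : \bar R :=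
  match pselect (exists f, density nu mu f) with
  | left H =>
      let f := projT1 (cid H) in
      if pselect (nu.-integrable setT (fun x => (f x * ln (f x))%:E)) then
        let nuf := fine (\int[nu]_x (f x)%:E) in
        \int[nu]_x (f x * ln (f x))%:E - (nuf * ln nuf)%:E
      else +oo
  | right _ => +oo
  end.
End mrws_meas.

(* Main.v *)
(* Follow the discrete heat flow f' = (1 - e) f + e M f of the density f of mu,
   where M f x is the average of f under m_x. By reversibility the entropy drops
   by at least 2 e I(f) + O(e^2) at each step, because
   (a - b) (ln a - ln b) >= 4 (sqrt a - sqrt b)^2. Transporting only the net flow
   between points costs at most e sqrt (2 Theta I(f)), by the Cauchy-Schwarz
   inequality applied to |a - b| = |sqrt a - sqrt b| (sqrt a + sqrt b). With the
   hypothesis W1 <= sqrt I / K, the square of W1 decreases by at most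
   2 e (sqrt (2 Theta) / K) I(f), that is sqrt (2 Theta) / K times the entropy
   drop. The total entropy drop being finite, I tends to 0 along the flow, hence
   so does W1. Since the flow comes with explicit couplings, neither
   Kantorovich duality nor disintegration is needed. The error terms require f to
   be bounded away from 0 and infinity; a general density is truncated and mixed
   with the uniform one. *)
Require Import Defs.
From HB Require Import structures.
From mathcomp Require Import all_boot all_order all_algebra.
From mathcomp Require Import all_classical all_reals all_analysis ess_sup_inf.
From mathcomp Require Import measurable_realfun.
From mathcomp Require Import ring lra.
Import Order.TTheory GRing.Theory Num.Def Num.Theory.
Import numFieldNormedType.Exports.
Local Open Scope classical_set_scope.
Local Open Scope ring_scope.
Local Open Scope ereal_scope.

(** * Scalar inequalities for the logarithm, the root and Young's inequality *)

Section entropy_reals.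
Set Implicit Arguments.
Unset Strict Implicit.
Local Open Scope ring_scope.
Context {R : realType}.
Implicit Types a b x y t : R.

(** The flow is run with a fixed step. A heat step with [0 < e < 1] keeps the density between its
    bounds [a] and [b], so the error of the entropy estimate has the same relative size [2 e b / a]
    at every step. It multiplies the energy instead of being added to it, hence does not accumulate,
    and [e] is sent to 0 only after the flow has been exploited. No limit along the flow is taken
    either: the energy falls below a threshold, where the hypothesis makes W1 small, or each step
    costs a fixed amount of entropy, which happens only finitely often.

    Truncation must be controlled in W1 on a possibly unbounded space. The hypothesis itself
    provides the control: I never exceeds 2, so W1 is at most [sqrt 2 / K] for every density, and
    all first moments share one bound. The small remainder of a truncation, once normalized, is a
    density too, hence cheap to move.

    All the measures needed (joint law, weighted measures, glued couplings) are specified by their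
    integrals, that is by positive functionals compatible with increasing limits. *)

Lemma ln_le_sub1 x : 0 < x -> ln x <= x - 1.
Proof.
move=> x0; have -> : x = 1 + (x - 1) by ring.
by rewrite [leRHS](_ : _ = x - 1); [apply: le_ln1Dx; lra|ring].
Qed.

(** The left side is [2 - 4 / (t + 1)], and [ln s + 4 / (s + 1)] is nondecreasing because its
    derivative is [(s - 1)^2 / (s (s + 1)^2)]; compare its values at 1 and [t]. *)
Lemma ln_ge_rational t : 1 <= t -> 2 * (t - 1) / (t + 1) <= ln t.
Proof.
move=> t1; pose g := fun s : R => ln s + 4 * (s + 1)^-1.
have dg x : 0 < x -> is_derive x 1 g (x^-1 + 4 * (- (x + 1) ^- 2)).
  move=> x0; have hx : x + 1 != 0 by lra.
  have h : is_derive x (1:R) (fun s : R => s + 1) 1.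
    by apply: is_derive_eq; rewrite addr0.
  have h2 := @is_deriveV R (fun s : R => s + 1) x 1 1 hx h.
  have h3 := @is_deriveZ R R R _ 4 x 1 _ h2.
  have h4 := is_deriveD (is_derive1_ln x0) h3.
  apply: is_derive_eq h4 _.
  by rewrite /GRing.scale/= mulr1.
have : g 1 <= g t.
  apply: (@ger0_derive1_le_cc _ g 1 t) => //.
  - by move=> x; rewrite in_itv/= => /andP[x1 _]; apply: ex_derive; apply: dg; lra.
  - move=> x; rewrite in_itv/= => /andP[x1 _].
    rewrite derive1E; have x0 : 0 < x by lra.
    have [_ ->] := dg x x0.
    have -> : x^-1 + 4 * - (x + 1) ^- 2 = (x - 1) ^+ 2 / (x * (x + 1) ^+ 2).
      by field; apply/andP; split; lra.
    by rewrite divr_ge0 ?sqr_ge0// mulr_ge0 ?sqr_ge0//; lra.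
  - apply: continuous_in_subspaceT => x; rewrite inE/= in_itv/= => /andP[x1 _].
    apply: differentiable_continuous; apply/derivable1_diffP.
    by apply: ex_derive; apply: dg; lra.
  - by rewrite in_itv/= lexx.
  - by rewrite in_itv/= lexx t1.
rewrite /g ln1 => h.
have -> : 2 * (t - 1) / (t + 1) = 0 + 4 * (1 + 1)^-1 - 4 * (t + 1)^-1.
  by field; lra.
lra.
Qed.

(** With [u = sqrt a >= v = sqrt b], a factor [2 (u - v)] comes out of both sides and
    [2 (u - v) <= (u + v) (ln u - ln v)] remains, which is [ln_ge_rational] at [u / v]. The constant
    4 is sharp as [a / b] tends to 1. *)
Lemma ln_sqrt_gap a b : 0 < a -> 0 < b ->
  4 * (sqrtr a - sqrtr b) ^+ 2 <= (a - b) * (ln a - ln b).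
Proof.
wlog ba : a b / b <= a.
  move=> H a0 b0; have [ba|ab] := leP b a; first exact: H.
  have := H _ _ (ltW ab) b0 a0; set u := sqrtr a; set v := sqrtr b; nra.
move=> a0 b0.
suff H (u v : R) : 0 < v -> 0 < u -> v <= u ->
    4 * (u - v) ^+ 2 <= (u ^+ 2 - v ^+ 2) * (ln (u ^+ 2) - ln (v ^+ 2)).
  have := H (sqrtr a) (sqrtr b); rewrite !sqr_sqrtr ?(ltW a0) ?(ltW b0)//.
  by apply; rewrite ?sqrtr_gt0 ?ler_wsqrtr.
move=> v0 u0 vu.
rewrite !lnXn//.
have := @ln_ge_rational (u / v).
rewrite ler_pdivlMr// mul1r => /(_ vu).
have -> : 2 * (u / v - 1) / (u / v + 1) = 2 * (u - v) / (u + v).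
  by field; rewrite ?andbT; lra.
rewrite ln_div ?posrE// ler_pdivrMr; last lra.
set L := ln u - ln v => h.
have -> : ln u *+ 2 - ln v *+ 2 = 2 * L by rewrite /L; ring.
have -> : (u ^+ 2 - v ^+ 2) * (2 * L) = 2 * (u - v) * (L * (u + v)) by ring.
have -> : 4 * (u - v) ^+ 2 = 2 * (u - v) * (2 * (u - v)) by ring.
by apply: ler_wpM2l => //; lra.
Qed.

(** The bound [ln (y / x) <= y / x - 1] turns [y (ln y - ln x)] into at most
    [(y - x) + (y - x)^2 / x], so the remainder only requires a lower bound on [x]. *)
Lemma xlnx_taylor a x y : 0 < a -> a <= x -> 0 < y ->
  y * ln y <= x * ln x + (y - x) * (1 + ln x) + (y - x) ^+ 2 / a.
Proof.
move=> a0 ax y0; have x0 : 0 < x by lra.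
have := @ln_le_sub1 (y / x); rewrite divr_gt0// => /(_ isT).
rewrite ln_div ?posrE// => h.
have h1 : y * (ln y - ln x) <= y * (y / x - 1) by apply: ler_wpM2l => //; lra.
have h2 : (y - x) ^+ 2 / x <= (y - x) ^+ 2 / a.
  by apply: ler_wpM2l; [exact: sqr_ge0|rewrite lef_pV2 ?posrE].
have h3 : y * (y / x - 1) = (y - x) + (y - x) ^+ 2 / x by field; lra.
lra.
Qed.

Lemma sqr_sub_sqrt b x y : 0 <= x -> 0 <= y -> x <= b -> y <= b ->
  (x - y) ^+ 2 <= 4 * b * (sqrtr x - sqrtr y) ^+ 2.
Proof.
move=> x0 y0 xb yb.
suff H (u v : R) : 0 <= u -> 0 <= v -> u ^+ 2 <= b -> v ^+ 2 <= b ->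
    (u ^+ 2 - v ^+ 2) ^+ 2 <= 4 * b * (u - v) ^+ 2.
  have := H (sqrtr x) (sqrtr y); rewrite !sqr_sqrtr//.
  by apply; rewrite ?sqrtr_ge0.
move=> u0 v0 ub vb.
have -> : (u ^+ 2 - v ^+ 2) ^+ 2 = (u + v) ^+ 2 * (u - v) ^+ 2 by ring.
by apply: ler_wpM2r; [exact: sqr_ge0|have := sqr_ge0 (u - v); nra].
Qed.

Lemma xlnx_ge_sub1 x : 0 <= x -> x - 1 <= x * ln x.
Proof.
rewrite le_eqVlt => /predU1P[<-|x0]; first by rewrite mul0r; lra.
have := @ln_le_sub1 x^-1; rewrite invr_gt0 lnV ?posrE// => /(_ x0) h.
have : x * (1 - x^-1) <= x * ln x by apply: ler_wpM2l; lra.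
by have -> : x * (1 - x^-1) = x - 1 by field; lra.
Qed.

(* Convexity of [t ln t] at the points [x] and [c / s]. *)
Lemma xlnx_mix (s c x : R) : 0 < s -> s < 1 -> 0 < c -> 0 <= x ->
  ((1 - s) * x + c) * ln ((1 - s) * x + c) <= (1 - s) * (x * ln x) + c * ln (c / s).
Proof.
move=> s0 s1 c0 x0; set y := (1 - s) * x + c.
have y0 : 0 < y by rewrite /y; nra.
(* The tangent of [t ln t] at [y] lies below the graph. As [y] is the barycentre of [x] and [c / s]
   with weights [1 - s] and [s], the terms [z - y] cancel in the weighted sum. *)
have tangent z : 0 <= z -> z * ln y + (z - y) <= z * ln z.
  rewrite le_eqVlt => /predU1P[<-|z0]; first by rewrite !mul0r; lra.
  have := @ln_le_sub1 (y / z); rewrite divr_gt0// => /(_ isT).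
  rewrite ln_div ?posrE// => h.
  have : z * (ln y - ln z) <= z * (y / z - 1) by apply: ler_wpM2l => //; lra.
  have -> : z * (y / z - 1) = y - z by field; lra.
  lra.
have h1 := tangent x x0.
have cs : 0 <= c / s by rewrite divr_ge0//; lra.
have h2 := tangent _ cs.
have -> : c * ln (c / s) = s * (c / s * ln (c / s)) by field; lra.
have k1 := @ler_wpM2l _ (1 - s) ltac:(lra) _ _ h1.
have k2 := @ler_wpM2l _ s ltac:(lra) _ _ h2.
apply: le_trans (lerD k1 k2).
have -> : s * (c / s * ln y + (c / s - y)) = c * ln y + (c - s * y) by field; lra.
rewrite le_eqVlt; apply/orP; left; apply/eqP.
by move: (ln y) => L; rewrite /y; ring.
Qed.

(** Recovers the Cauchy-Schwarz form from a family of Young inequalities, once these have been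
    integrated. *)
Lemma le_2sqrt_of_young (A B c : R) : 0 <= A -> 0 <= B ->
  (forall s, 0 < s -> c <= s * A + B / s) -> c <= 2 * sqrtr (A * B).
Proof.
move=> A0 B0 h.
have [c0|c0] := leP c 0; first by rewrite (le_trans c0)// mulr_ge0// sqrtr_ge0.
have [Az|Apos] := eqVneq A 0.
  (* For [A = 0] this [s] is so large that [B / s <= c / 2], which is absurd for [c > 0]. *)
  have := h (2 * (B + 1) / c); rewrite divr_gt0 => [/(_ isT)||//]; last lra.
  rewrite Az mulr0 add0r.
  have -> : B / (2 * (B + 1) / c) = c * (B / (2 * (B + 1))).
    by field; apply/andP; split; lra.
  have : B / (2 * (B + 1)) <= 2^-1 by rewrite ler_pdivrMr; lra.
  nra.
have A1 : 0 < A by rewrite lt_neqAle eq_sym Apos.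
(* This choice makes [s A = c / 2] and leaves [c^2 <= 4 A B]; unlike the optimal [sqrt (B / A)], it
   stays positive when [B = 0]. *)
have := h (c / (2 * A)); rewrite divr_gt0 => [/(_ isT)|//|]; last lra.
have -> : c / (2 * A) * A = c / 2 by field; lra.
have -> : B / (c / (2 * A)) = 2 * (A * B) / c by field; apply/andP; split; lra.
move=> h1.
have : c / 2 * c <= 2 * (A * B) by rewrite -ler_pdivlMr//; lra.
move=> h2.
have S0 : 0 <= 2 * sqrtr (A * B) by rewrite mulr_ge0// sqrtr_ge0.
rewrite leNgt; apply/negP => lt_c.
have : (2 * sqrtr (A * B)) ^+ 2 < c ^+ 2 by rewrite ltrXn2r// ltW.
by rewrite exprMn sqr_sqrtr ?mulr_ge0//; nra.
Qed.

(** Pointwise Cauchy-Schwarz: [p] and [q] stand for the roots of the density at two points, [D] for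
    their distance. The flows in the two directions add up to [e |q - p| (q + p) D]. The parameter
    [s] is optimized only after integration. *)
Lemma flux_young (e s p q D : R) : 0 < e -> 0 < s -> 0 <= p -> 0 <= q -> 0 <= D ->
  e * Num.max (p ^+ 2 - q ^+ 2) 0 * D + e * Num.max (q ^+ 2 - p ^+ 2) 0 * D <=
  e * (s / 2) * (q - p) ^+ 2 + (e / s * (p ^+ 2 * D ^+ 2) + e / s * (q ^+ 2 * D ^+ 2)).
Proof.
move=> e0 s0 p0 q0 D0.
have H : e * `|q ^+ 2 - p ^+ 2| * D <=
    e * (s / 2) * (q - p) ^+ 2 + (e / s * (p ^+ 2 * D ^+ 2) + e / s * (q ^+ 2 * D ^+ 2)).
  have -> : q ^+ 2 - p ^+ 2 = (q - p) * (q + p) by ring.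
  rewrite normrM (ger0_norm (addr_ge0 q0 p0)).
  rewrite -(real_normK (num_real (q - p))); move: `|q - p| => v.
  (* The first square is Young's inequality, the second the slack in
     [(p + q)^2 <= 2 p^2 + 2 q^2]. *)
  have : 0 <= e / (2 * s) * ((s * v - (q + p) * D) ^+ 2 + (q - p) ^+ 2 * D ^+ 2).
    apply: mulr_ge0; first by rewrite divr_ge0 ?mulr_ge0 ?ltW.
    by apply: addr_ge0; [exact: sqr_ge0|apply: mulr_ge0; exact: sqr_ge0].
  have -> : e / (2 * s) * ((s * v - (q + p) * D) ^+ 2 + (q - p) ^+ 2 * D ^+ 2) =
      e * (s / 2) * v ^+ 2 + (e / s * (p ^+ 2 * D ^+ 2) + e / s * (q ^+ 2 * D ^+ 2))
      - e * (v * (q + p)) * D by field; exact: lt0r_neq0.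
  by rewrite subr_ge0.
apply: le_trans H; have [pq|qp] := leP (p ^+ 2) (q ^+ 2).
  have -> : Num.max (p ^+ 2 - q ^+ 2) 0 = 0 by apply/max_idPr; rewrite subr_le0.
  have -> : Num.max (q ^+ 2 - p ^+ 2) 0 = q ^+ 2 - p ^+ 2.
    by apply/max_idPl; rewrite subr_ge0.
  by rewrite ger0_norm ?subr_ge0// mulr0 mul0r add0r.
have -> : Num.max (q ^+ 2 - p ^+ 2) 0 = 0 by apply/max_idPr; rewrite subr_le0 ltW.
have -> : Num.max (p ^+ 2 - q ^+ 2) 0 = p ^+ 2 - q ^+ 2.
  by apply/max_idPl; rewrite subr_ge0 ltW.
by rewrite distrC ger0_norm ?subr_ge0 ?(ltW qp)// mulr0 mul0r addr0.
Qed.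

End entropy_reals.

(** * Measures given by their integrals *)

Definition pos_measurable {d} {T : measurableType d} {R : realType}
    (f : T -> \bar R) : Prop :=
  measurable_fun setT f /\ forall x, 0 <= f x.

Section positive_functional.
Set Implicit Arguments.
Unset Strict Implicit.
Context d (T : measurableType d) (R : realType).
Variable Phi : (T -> \bar R) -> \bar R.
Hypothesis Phi_ge0 : forall f, pos_measurable f -> 0 <= Phi f.
Hypothesis PhiZ : forall (c : R) f, (0 <= c)%R -> pos_measurable f ->
  Phi (fun x => c%:E * f x) = c%:E * Phi f.
Hypothesis PhiD : forall f g, pos_measurable f -> pos_measurable g ->
  Phi (fun x => f x + g x) = Phi f + Phi g.
Hypothesis Phi_lim : forall f_ : nat -> T -> \bar R,
  (forall n, pos_measurable (f_ n)) ->
  (forall x, nondecreasing_seq (f_ ^~ x)) ->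
  Phi (fun x => limn (f_ ^~ x)) = limn (fun n => Phi (f_ n)).

Let pos_measurable_indic (A : set T) : measurable A ->
  pos_measurable (fun x => (\1_A x : R)%:E).
Proof.
by move=> mA; split=> [|x]; [exact/measurable_EFinP|rewrite lee_fin].
Qed.

Let pos_measurable0 : pos_measurable (fun _ : T => 0 : \bar R).
Proof. by split. Qed.

Let Phi0 : Phi (fun=> 0) = 0.
Proof.
have := @PhiZ 0%R (fun=> 0) (lexx _) pos_measurable0.
by under eq_fun do rewrite mul0e; rewrite mul0e.
Qed.

Let Phi_sum I (s : seq I) (F : I -> T -> \bar R) :
  (forall i, pos_measurable (F i)) ->
  pos_measurable (fun x => \sum_(i <- s) F i x) /\
  Phi (fun x => \sum_(i <- s) F i x) = \sum_(i <- s) Phi (F i).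
Proof.
move=> mF; elim: s => [|i s [ms IH]].
  under eq_fun do rewrite big_nil; rewrite big_nil; split; first by split.
  exact: Phi0.
under eq_fun do rewrite big_cons; rewrite big_cons -IH -PhiD//; split => //.
split=> [|x]; first by apply: emeasurable_funD; [exact: (mF i).1|exact: ms.1].
by apply: adde_ge0; [exact: (mF i).2|exact: ms.2].
Qed.

(** The value 0 off the measurable sets is a default: a measure must be nonnegative on every set,
    while [Phi] is controlled on measurable functions only. *)
Let phi (A : set T) : \bar R :=
  if `[< measurable A >] then Phi (fun x => (\1_A x)%:E) else 0.

Let phiE A : measurable A -> phi A = Phi (fun x => (\1_A x)%:E).
Proof. by move=> mA; rewrite /phi; case: asboolP. Qed.

Let phi0 : phi set0 = 0.
Proof. by rewrite phiE//; under eq_fun do rewrite indic0; rewrite Phi0. Qed.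

Let phi_ge0 A : 0 <= phi A.
Proof. by rewrite /phi; case: asboolP => // mA; exact/Phi_ge0/pos_measurable_indic. Qed.

Let phi_sigma_additive : semi_sigma_additive phi.
Proof.
move=> F mF tF mUF.
have indicU x : (\1_(\bigcup_n F n) x)%:E =
    limn (fun n => \sum_(0 <= i < n) (\1_(F i) x : R)%:E).
  apply/esym/cvg_lim => //.
  (* At a fixed [x], the expansion of the indicator of the union is the additivity of the Dirac mass
     at [x]. *)
  exact: (@measure_semi_sigma_additive _ _ _ (\d_x) F mF tF mUF).
have partial n := @Phi_sum _ (index_iota 0 n) (fun i x => (\1_(F i) x)%:E)
  (fun i => pos_measurable_indic (mF i)).
rewrite phiE// (_ : (fun x => (\1_(\bigcup_n F n) x)%:E) =
    fun x => limn (fun n => \sum_(0 <= i < n) (\1_(F i) x)%:E)); last first.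
  by apply/funext => x; exact: indicU.
rewrite Phi_lim; last 2 first.
- by move=> n; exact: (partial n).1.
- by move=> x m n mn; apply: lee_sum_nneg_natr.
rewrite (_ : (fun n => \sum_(0 <= i < n) phi (F i)) =
    fun n => Phi (fun x => \sum_(0 <= i < n) (\1_(F i) x)%:E)); last first.
  apply/funext => n; rewrite (partial n).2; apply: eq_bigr => i _.
  by rewrite phiE.
have : cvgn (fun n => \sum_(0 <= i < n) Phi (fun x => (\1_(F i) x)%:E)).
  by apply: is_cvg_nneseries => n _ _; exact/Phi_ge0/pos_measurable_indic.
by under eq_fun do rewrite -(partial _).2.
Qed.

HB.instance Definition _ := isMeasure.Build d T R phi phi0 phi_ge0 phi_sigma_additive.

Import HBNNSimple.

Let integral_phi_nnsfun (f : {nnsfun T >-> R}) :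
  \int[phi]_x (f x)%:E = Phi (fun x => (f x)%:E).
Proof.
rewrite integral_nnsfun// patch_setT sintegralE fsbig_finite//=.
under [X in _ = Phi X]eq_fun do rewrite fimfunE -fsumEFin// fsbig_finite//=.
have term r : pos_measurable (fun x => (r * \1_(f @^-1` [set r]) x)%:E).
  split=> [|x]; last by rewrite EFinM nnfun_muleindic_ge0.
  by apply/measurable_EFinP; exact: measurable_funM.
rewrite (Phi_sum _ term).2; apply: eq_bigr => r _.
(* [PhiZ] covers nonnegative factors only; a negative [r] is not a value of [f], so its preimage is
   empty. *)
have [r0|r0] := leP 0%R r.
  under eq_fun do rewrite EFinM.
  by rewrite PhiZ//; [rewrite phiE|exact: pos_measurable_indic].
rewrite preimage_nnfun0// phi0 mule0.
by under eq_fun do rewrite indic0 mulr0; rewrite Phi0.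
Qed.

(** The values of [Phi] on indicators are sigma-additive by [Phi_lim]. The integral agrees with
    [Phi] on simple functions by linearity, then on all nonnegative measurable functions since both
    sides commute with increasing limits. *)
Lemma measure_of_functional : exists mu : {measure set T -> \bar R},
  forall f, pos_measurable f -> \int[mu]_x f x = Phi f.
Proof.
exists phi => f [mf f0].
pose f_ := nnsfun_approx measurableT mf.
have fE x : f x = limn (fun n => (f_ n x)%:E).
  by apply/esym/cvg_lim => //; exact: cvg_nnsfun_approx.
have ndf x : nondecreasing_seq (fun n => (f_ n x)%:E).
  by move=> m n mn; rewrite lee_fin; exact/lefP/nd_nnsfun_approx.
have mf_ n : pos_measurable (fun x => (f_ n x)%:E).
  by split=> [|x]; [exact/measurable_EFinP|rewrite lee_fin].
under eq_integral do rewrite fE.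
rewrite (_ : f = fun x => limn (fun n => (f_ n x)%:E)); last first.
  by apply/funext => x; exact: fE.
rewrite Phi_lim// monotone_convergence//.
- by congr (limn _); apply/funext => n; exact: integral_phi_nnsfun.
- by move=> n; exact: (mf_ n).1.
- by move=> n x _; exact: (mf_ n).2.
Qed.

End positive_functional.

(** * Probabilities obtained from kernels and from densities *)

Section constructions.
Set Implicit Arguments.
Unset Strict Implicit.
Context {R : realType}.

Lemma pos_measurable_EFin d (T : measurableType d) (f : T -> R) :
  measurable_fun setT f -> (forall x, (0 <= f x)%R) ->
  pos_measurable (fun x => (f x)%:E).
Proof. by split=> [|x]; [exact/measurable_EFinP|rewrite lee_fin]. Qed.

Lemma pos_measurable_indic d (T : measurableType d) (A : set T) :
  measurable A -> pos_measurable (fun x => (\1_A x : R)%:E).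
Proof. by move=> mA; apply: pos_measurable_EFin. Qed.

Lemma pos_measurableM d (T : measurableType d) (f g : T -> \bar R) :
  pos_measurable f -> pos_measurable g -> pos_measurable (fun x => f x * g x).
Proof.
by move=> [mf f0] [mg g0]; split=> [|x]; [exact: emeasurable_funM|exact: mule_ge0].
Qed.

Lemma pos_measurableD d (T : measurableType d) (f g : T -> \bar R) :
  pos_measurable f -> pos_measurable g -> pos_measurable (fun x => f x + g x).
Proof.
by move=> [mf f0] [mg g0]; split=> [|x]; [exact: emeasurable_funD|exact: adde_ge0].
Qed.

Lemma pos_measurable_comp d d' (T : measurableType d) (U : measurableType d')
    (f : U -> \bar R) (g : T -> U) :
  pos_measurable f -> measurable_fun setT g -> pos_measurable (fun x => f (g x)).
Proof. by move=> [mf f0] mg; split=> // ; exact: measurableT_comp. Qed.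

Lemma pos_measurable_kernel d d' (T : measurableType d) (U : measurableType d')
    (k : R.-fker T ~> U) (f : T * U -> \bar R) :
  pos_measurable f -> pos_measurable (fun x => \int[k x]_y f (x, y)).
Proof.
move=> [mf f0]; split=> [|x]; last by apply: integral_ge0.
exact: measurable_fun_integral_finite_kernel.
Qed.

Lemma pos_int_lim d (T : measurableType d) (mu : {measure set T -> \bar R})
    (f : nat -> T -> \bar R) :
  (forall n, pos_measurable (f n)) -> (forall x, nondecreasing_seq (f ^~ x)) ->
  \int[mu]_x limn (f ^~ x) = limn (fun n => \int[mu]_x f n x).
Proof.
move=> mf ndf; apply: monotone_convergence => //.
- by move=> n; exact: (mf n).1.
- by move=> n x _; exact: (mf n).2.
Qed.

Lemma pos_intD d (T : measurableType d) (mu : {measure set T -> \bar R})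
    (f g : T -> \bar R) : pos_measurable f -> pos_measurable g ->
  \int[mu]_x (f x + g x) = \int[mu]_x f x + \int[mu]_x g x.
Proof. by move=> [mf f0] [mg g0]; apply: ge0_integralD. Qed.

Lemma pos_intZ d (T : measurableType d) (mu : {measure set T -> \bar R})
    (c : R) (f : T -> \bar R) : (0 <= c)%R -> pos_measurable f ->
  \int[mu]_x (c%:E * f x) = c%:E * \int[mu]_x f x.
Proof. by move=> c0 [mf f0]; apply: ge0_integralZl => //; rewrite lee_fin. Qed.

Lemma pos_le_int d (T : measurableType d) (mu : {measure set T -> \bar R})
    (f g : T -> \bar R) : pos_measurable f -> pos_measurable g ->
  (forall x, f x <= g x) -> \int[mu]_x f x <= \int[mu]_x g x.
Proof. by move=> [mf f0] [mg g0] fg; apply: ge0_le_integral. Qed.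

Lemma prob_eint_cst d (T : measurableType d) (P : probability T R) (c : \bar R) :
  \int[P]_x c = c.
Proof.
rewrite integral_cst//; apply: etrans (mule1 c); congr (c * _).
exact: probability_setT.
Qed.

Lemma measure_as_integral d (T : measurableType d) (mu : {measure set T -> \bar R})
    (A : set T) : measurable A -> mu A = \int[mu]_x (\1_A x)%:E.
Proof. by move=> mA; rewrite integral_indic// setIT. Qed.

(** Normalizing a measure of mass 1 leaves it unchanged and equips it with the structure of a
    probability. The Dirac mass is the fallback for mass zero or infinity, which does not occur
    here. *)
Lemma probability_of_measure d (T : measurableType d)
    (mu : {measure set T -> \bar R}) : \int[mu]_x 1 = 1 ->
  exists P : probability T R, forall f, \int[P]_x f x = \int[mu]_x f x.
Proof.
rewrite integral_cst// mul1e => mu1.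
exists (mnormalize mu (\d_point)) => f.
apply: eq_measure_integral => A mA _; rewrite -[LHS]/(mnormalize mu (\d_point) A).
rewrite /mnormalize mu1 eqe oner_eq0 orFb (_ : (1 == +oo) = false)//.
by rewrite (_ : fine 1 = 1%R)// invr1 mule1.
Qed.

(** Turns the iterated integrals in the Dirichlet form into integrals against one probability on
    pairs, for which reversibility becomes invariance under exchange of the coordinates. *)
Lemma kernel_joint d d' (T : measurableType d) (U : measurableType d')
    (nu : probability T R) (k : R.-pker T ~> U) :
  exists P : probability (T * U)%type R, forall f, pos_measurable f ->
    \int[P]_z f z = \int[nu]_x \int[k x]_y f (x, y).
Proof.
have sec (f : T * U -> \bar R) x : pos_measurable f ->
    pos_measurable (fun y => f (x, y)).
  by move=> mf; apply: pos_measurable_comp mf _.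
have [||||mu muE] := @measure_of_functional _ (T * U)%type R
  (fun f => \int[nu]_x \int[k x]_y f (x, y)).
- by move=> f [mf f0]; apply: integral_ge0 => x _; exact: integral_ge0.
- move=> c f c0 mf; rewrite -pos_intZ//; last exact: pos_measurable_kernel.
  by apply: eq_integral => x _; rewrite pos_intZ//; exact: sec.
- move=> f g mf mg; rewrite -pos_intD; try exact: pos_measurable_kernel.
  by apply: eq_integral => x _; rewrite pos_intD//; exact: sec.
- move=> f mf ndf; rewrite -pos_int_lim.
  + apply: eq_integral => x _.
    by rewrite (@pos_int_lim _ _ _ (fun n y => f n (x, y)))// => n; exact: sec.
  + by move=> n; exact: pos_measurable_kernel.
  + move=> x m n mn; apply: pos_le_int; try exact: sec.
    by move=> y; exact: ndf.
have [|P PE] := @probability_of_measure _ _ mu; last first.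
  by exists P => f mf; rewrite PE muE.
rewrite muE; last by split.
under eq_integral do rewrite integral_cst// mul1e prob_kernel.
by rewrite integral_cst// mul1e; exact: probability_setT.
Qed.

Lemma weighted_measure d (T : measurableType d) (nu : {measure set T -> \bar R})
    (f : T -> R) :
  measurable_fun setT f -> (forall x, (0 <= f x)%R) ->
  exists mu : {measure set T -> \bar R}, forall g, pos_measurable g ->
    \int[mu]_x g x = \int[nu]_x ((f x)%:E * g x).
Proof.
move=> mf f0; have pf := pos_measurable_EFin mf f0.
apply: measure_of_functional.
- by move=> h [mh h0]; apply: integral_ge0 => x _; rewrite mule_ge0// lee_fin.
- move=> c h c0 mh; rewrite -pos_intZ//; last exact: pos_measurableM.
  by apply: eq_integral => x _; rewrite muleCA.
- move=> h1 h2 mg1 mh; rewrite -pos_intD; try exact: pos_measurableM.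
  by apply: eq_integral => x _; rewrite ge0_muleDr; [|exact: mg1.2|exact: mh.2].
- move=> h mh ndg; rewrite -pos_int_lim.
  + apply: eq_integral => x _; rewrite limeMl//.
    exact: ereal_nondecreasing_is_cvgn.
  + by move=> n; exact: pos_measurableM.
  + by move=> x m n mn; apply: lee_wpmul2l; [rewrite lee_fin|exact: ndg].
Qed.

Lemma int_mul_indic d (T : measurableType d) (nu : {measure set T -> \bar R})
    (f : T -> R) (A : set T) :
  \int[nu]_x ((f x)%:E * (\1_A x)%:E) = \int[nu]_(x in A) (f x)%:E.
Proof.
by rewrite [RHS]integral_mkcond; apply: eq_integral => x _; rewrite epatch_indic.
Qed.

Lemma density_exists d (T : measurableType d) (nu : probability T R) (f : T -> R) :
  measurable_fun setT f -> (forall x, (0 <= f x)%R) ->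
  \int[nu]_x (f x)%:E = 1 ->
  exists P : probability T R, density nu P f.
Proof.
move=> mf f0 f1; have [mu muE] := weighted_measure nu mf f0.
have [|P PE] := @probability_of_measure _ _ mu.
  by rewrite muE; [under eq_integral do rewrite mule1|split].
exists P; split=> // A mA.
have := PE (fun x => (\1_A x)%:E); rewrite integral_indic// setIT => ->.
by rewrite muE ?int_mul_indic//; exact: pos_measurable_indic.
Qed.

Lemma density_integral d (T : measurableType d) (nu P : probability T R)
    (f : T -> R) (g : T -> \bar R) : density nu P f -> pos_measurable g ->
  \int[P]_x g x = \int[nu]_x ((f x)%:E * g x).
Proof.
move=> [mf f0 PE] mg; have [mu muE] := weighted_measure nu mf f0.
rewrite -muE//; apply: eq_measure_integral => A mA _.
have := muE _ (pos_measurable_indic mA).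
rewrite integral_indic// setIT => ->; rewrite int_mul_indic; exact: PE.
Qed.

End constructions.

Section kernel_fst.
Set Implicit Arguments.
Unset Strict Implicit.
Context d d' d'' (T : measurableType d) (U : measurableType d')
  (V : measurableType d'') (R : realType) (k : R.-pker T ~> V).

(** In the gluing, a pair [(y, z)] is fixed and [x] is drawn at [y]. Seeing this as a kernel from
    pairs gives measurability in [(y, z)] of the integral over [x]. *)
Definition kfst (z : T * U) : {measure set V -> \bar R} := k z.1.

Let measurable_kfst A : measurable A -> measurable_fun setT (kfst ^~ A).
Proof. by move=> mA; exact: measurableT_comp (measurable_kernel k _ mA) _. Qed.

HB.instance Definition _ := isKernel.Build _ _ _ _ _ kfst measurable_kfst.

Let kfst_prob z : kfst z setT = 1.
Proof. exact: prob_kernel. Qed.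

HB.instance Definition _ := Kernel_isProbability.Build _ _ _ _ _ kfst kfst_prob.

End kernel_fst.

(** * Gluing a kernel onto a coupling *)

Section metric.
Set Implicit Arguments.
Unset Strict Implicit.
Context {R : realType} {d : measure_display} {X : measurableType d}.
Variable dist : X -> X -> R.
Hypothesis polish : polish_metric dist.
Hypothesis borel : borel_of_metric dist.
Implicit Types mu nu : probability X R.

Lemma dist_sym x y : dist x y = dist y x.
Proof. by have [[_ [+ _]] _ _] := polish; apply. Qed.

Lemma dist_triangle x y z : (dist x z <= dist x y + dist y z)%R.
Proof. by have [[_ [_ +]] _ _] := polish; apply. Qed.

Lemma dist_eq0 x y : dist x y = 0%R <-> x = y.
Proof. by have [[+ _] _ _] := polish; apply. Qed.

Lemma dist_ge0 x y : (0 <= dist x y)%R.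
Proof.
have := dist_triangle x y x; rewrite (dist_sym y x).
by have /dist_eq0 -> : x = x by []; lra.
Qed.

Lemma measurable_fun_lt d' (T : measurableType d') (f : T -> R) :
  (forall r, measurable [set x | (f x < r)%R]) -> measurable_fun setT f.
Proof.
move=> mf; apply: (measurability _ (RGenInftyO.measurableE R)) => _ /= -[_ [r ->] <-].
by rewrite setTI (_ : _ @^-1` _ = [set x | (f x < r)%R]).
Qed.

Lemma measurable_dist_from c : measurable_fun setT (dist c).
Proof.
apply: measurable_fun_lt => r; apply/borel; apply: sub_sigma_algebra => x /= xr.
exists (r - dist c x)%R; first by rewrite subr_gt0.
move=> y /= xy; have := dist_triangle c x y; lra.
Qed.

(** Separability is what places the distance in the product sigma-algebra: [dist x y < r] holds
    exactly when [dist c x + dist c y < r] for some [c] in the countable dense set, found within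
    half the slack of [x]. *)
Lemma measurable_dist : measurable_fun setT (fun z : X * X => dist z.1 z.2).
Proof.
have [_ _ [D [cD dD]]] := polish.
apply: measurable_fun_lt => r.
rewrite (_ : [set z | _] =
    \bigcup_(c in D) [set z : X * X | (dist c z.1 + dist c z.2 < r)%R]).
  rewrite bigcup_set_type; apply: countable_bigcupT_measurable => [|c].
    by rewrite (eq_countable (card_setT _)).
  have mc : measurable_fun setT (fun z : X * X => dist (val c) z.1 + dist (val c) z.2)%R.
    by apply: measurable_funD; apply: measurableT_comp (measurable_dist_from (val c)) _.
  have := mc measurableT `]-oo, r[%classic (measurable_itv _); rewrite setTI.
  by congr measurable; apply/seteqP; split => z /=; rewrite in_itv.
apply/seteqP; split => [[x y] /= xyr|[x y] /= [c Dc cr]]; last first.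
  move: cr => /= cr; have := dist_triangle x c y; rewrite (dist_sym x c); lra.
have [|c Dc xc] := dD x ((r - dist x y) / 2)%R; first lra.
exists c => //=; have := dist_triangle c x y; rewrite (dist_sym c x); lra.
Qed.

Lemma pos_measurable_dist : pos_measurable (fun z : X * X => (dist z.1 z.2)%:E).
Proof.
by apply: pos_measurable_EFin => [|z]; [exact: measurable_dist|exact: dist_ge0].
Qed.

Lemma pos_measurable_dist_to c : pos_measurable (fun x => (dist x c)%:E).
Proof.
under eq_fun do rewrite dist_sym.
by apply: pos_measurable_EFin => [|z]; [exact: measurable_dist_from|exact: dist_ge0].
Qed.

Lemma coupling_fst mu nu (pi : probability (X * X)%type R) (g : X -> \bar R) :
  coupling mu nu pi -> pos_measurable g -> \int[pi]_z g z.1 = \int[mu]_x g x.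
Proof.
move=> cpi [mg g0].
transitivity (\int[pushforward pi fst]_x g x).
  by rewrite ge0_integral_pushforward// preimage_setT.
apply: eq_measure_integral => A mA _.
have [H _] := cpi _ mA; apply: etrans H; rewrite /pushforward /=; congr (pi _).
by apply/seteqP; split => [z|z []].
Qed.

Lemma coupling_snd mu nu (pi : probability (X * X)%type R) (g : X -> \bar R) :
  coupling mu nu pi -> pos_measurable g -> \int[pi]_z g z.2 = \int[nu]_x g x.
Proof.
move=> cpi [mg g0].
transitivity (\int[pushforward pi snd]_x g x).
  by rewrite ge0_integral_pushforward// preimage_setT.
apply: eq_measure_integral => A mA _.
have [_ H] := cpi _ mA; apply: etrans H; rewrite /pushforward /=; congr (pi _).
by apply/seteqP; split => [z|z []].
Qed.

Lemma W1_ge0 mu nu : 0 <= W1 dist mu nu.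
Proof.
apply: le_ereal_inf_tmp => _ [pi _ <-]; apply: integral_ge0 => z _.
by rewrite lee_fin dist_ge0.
Qed.

(* [mu] is obtained from [mu'] by the kernel sending [y] to
   [rho y \d_y + k (y, x) lam_y(dx)]; gluing that kernel onto a coupling of
   [mu'] and [nu] needs no disintegration. *)
Lemma W1_glue (mu mu' nu : probability X R) (lam : R.-pker X ~> X)
    (rho : X -> R) (k : X * X -> R) :
  measurable_fun setT rho -> (forall x, (0 <= rho x)%R) ->
  measurable_fun setT k -> (forall z, (0 <= k z)%R) ->
  (forall y, (rho y)%:E + \int[lam y]_x (k (y, x))%:E = 1) ->
  (forall A, measurable A -> mu A =
    \int[mu']_y ((rho y)%:E * (\1_A y)%:E
      + \int[lam y]_x ((k (y, x))%:E * (\1_A x)%:E))) ->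
  W1 dist mu nu <=
    \int[mu']_y \int[lam y]_x ((k (y, x))%:E * (dist x y)%:E) + W1 dist mu' nu.
Proof.
move=> mrho rho0 mk k0 rhok1 muE.
have prho := pos_measurable_EFin mrho rho0.
have pk := pos_measurable_EFin mk k0.
have psec (f : X * X -> \bar R) z : pos_measurable f ->
    pos_measurable (fun x => (k (z.1, x))%:E * f (x, z.2)).
  move=> pf; apply: pos_measurableM.
    by apply: pos_measurable_comp pk _; exact: measurable_fun_pair.
  by apply: pos_measurable_comp pf _; exact: measurable_fun_pair.
(* The expected value of [f] after the kernel moves the first point of the pair and keeps the
   second. Integrating it against [pi] defines the glued coupling. *)
pose G (f : X * X -> \bar R) (z : X * X) :=
  (rho z.1)%:E * f z + \int[lam z.1]_x ((k (z.1, x))%:E * f (x, z.2)).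
have pG2 (f : X * X -> \bar R) : pos_measurable f ->
    pos_measurable (fun z => \int[lam z.1]_x ((k (z.1, x))%:E * f (x, z.2))).
  move=> pf; suff H : pos_measurable (fun w : X * X * X =>
      (k (w.1.1, w.2))%:E * f (w.2, w.1.2)).
    exact: (pos_measurable_kernel (kfst lam) H).
  apply: pos_measurableM.
    apply: pos_measurable_comp pk _; apply: measurable_fun_pair => //.
    exact: measurableT_comp.
  apply: pos_measurable_comp pf _; apply: measurable_fun_pair => //.
  exact: measurableT_comp.
have pG1 (f : X * X -> \bar R) : pos_measurable f ->
    pos_measurable (fun z => (rho z.1)%:E * f z).
  by move=> pf; apply: pos_measurableM pf; exact: pos_measurable_comp prho _.
have pG (f : X * X -> \bar R) : pos_measurable f -> pos_measurable (G f).
  by move=> pf; apply: pos_measurableD; [exact: pG1|exact: pG2].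
have glue pi : coupling mu' nu pi -> exists2 pi', coupling mu nu pi' &
    forall f, pos_measurable f -> \int[pi']_z f z = \int[pi]_z G f z.
  move=> cpi.
  have [||||M ME] := @measure_of_functional _ (X * X)%type R
      (fun f => \int[pi]_z G f z).
  - by move=> f /pG [_ pGf]; exact: integral_ge0.
  - move=> c f c0 pf; rewrite -pos_intZ//; last exact: pG.
    apply: eq_integral => z _; rewrite /G ge0_muleDr ?(pG1 f pf).2 ?(pG2 f pf).2//.
    rewrite muleCA -pos_intZ//; last exact: psec.
    by congr (_ + _); apply: eq_integral => x _; rewrite muleCA.
  - move=> f g pf pg; rewrite -pos_intD; try exact: pG.
    apply: eq_integral => z _; rewrite /G.
    rewrite addeACA -ge0_muleDr ?pf.2 ?pg.2//; congr (_ + _).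
    rewrite -pos_intD; try exact: psec.
    by apply: eq_integral => x _; rewrite ge0_muleDr ?pf.2 ?pg.2.
  - move=> f pf ndf.
    have ndG2 z : nondecreasing_seq
        (fun n => \int[lam z.1]_x ((k (z.1, x))%:E * f n (x, z.2))).
      move=> m n mn; apply: pos_le_int => [||x]; try exact: psec.
      by apply: lee_wpmul2l; [rewrite lee_fin|exact: ndf].
    have ndG1 z : nondecreasing_seq (fun n => (rho z.1)%:E * f n z).
      by move=> m n mn; apply: lee_wpmul2l; [rewrite lee_fin|exact: ndf].
    rewrite -pos_int_lim.
    + apply: eq_integral => z _; rewrite /G.
      rewrite [X in _ = limn X](_ : _ = (fun n => (rho z.1)%:E * f n z) \+
        (fun n => \int[lam z.1]_x ((k (z.1, x))%:E * f n (x, z.2))))//.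
      have cv1 := ereal_nondecreasing_is_cvgn (ndG1 z).
      have cv2 := ereal_nondecreasing_is_cvgn (ndG2 z).
      rewrite limeD//; last first.
        apply: ge0_adde_def; rewrite inE; apply: lime_ge => //; apply: nearW => n.
          exact: (pG1 _ (pf n)).2.
        exact: (pG2 _ (pf n)).2.
      rewrite limeMl//; last exact: ereal_nondecreasing_is_cvgn.
      congr (_ + _); rewrite -pos_int_lim.
      * apply: eq_integral => x _; rewrite limeMl//.
        exact: ereal_nondecreasing_is_cvgn.
      * by move=> n; exact: psec.
      * by move=> x m n mn; apply: lee_wpmul2l; [rewrite lee_fin|exact: ndf].
    + by move=> n; exact: pG.
    + by move=> z m n mn; apply: leeD; [exact: ndG1|exact: ndG2].
  have [|P PE] := @probability_of_measure _ _ _ M.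
    rewrite ME; last by split.
    under eq_integral.
      move=> z _; rewrite /G mule1; under eq_integral do rewrite mule1.
      rewrite rhok1; over.
    by rewrite integral_cst// mul1e; exact: probability_setT.
  exists P => [A mA|f pf]; last by rewrite PE ME.
  have indicP B : measurable B -> P B = \int[pi]_z G (fun w => (\1_B w)%:E) z.
    move=> mB; rewrite -ME; last exact: pos_measurable_indic.
    by rewrite -PE integral_indic// setIT.
  split.
  - rewrite indicP; last exact: measurableX.
    rewrite muE// -(coupling_fst cpi); last first.
      apply: pos_measurableD.
        by apply: pos_measurableM => //; exact: pos_measurable_indic.
      apply: (@pos_measurable_kernel _ _ _ _ _ lam
        (fun z : X * X => (k z)%:E * (\1_A z.2)%:E)).
      apply: pos_measurableM => //.
      by apply: pos_measurable_comp (pos_measurable_indic mA) _.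
    apply: eq_integral => z _; rewrite /G !indicE in_setX in_setT andbT.
    congr (_ + _); apply: eq_integral => x _.
    by rewrite !indicE in_setX in_setT andbT.
  - rewrite indicP; last exact: measurableX.
    rewrite (_ : nu A = \int[pi]_z (\1_A z.2)%:E); last first.
      by rewrite (coupling_snd cpi (pos_measurable_indic mA)) integral_indic// setIT.
    apply: eq_integral => z _; rewrite /G !indicE in_setX in_setT/=.
    under eq_integral do rewrite indicE in_setX in_setT/= muleC.
    rewrite pos_intZ//; last first.
      by apply: pos_measurable_comp pk _; exact: measurable_fun_pair.
    rewrite muleC -ge0_muleDr ?rhok1 ?mule1// ?lee_fin//.
    by apply: integral_ge0 => x _; rewrite lee_fin.
set c := \int[mu']_y _.
have pc : pos_measurable (fun y => \int[lam y]_x ((k (y, x))%:E * (dist x y)%:E)).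
  apply: (@pos_measurable_kernel _ _ _ _ _ lam
    (fun z : X * X => (k z)%:E * (dist z.2 z.1)%:E)).
  apply: pos_measurableM => //; under eq_fun do rewrite dist_sym.
  exact: pos_measurable_dist.
have c0 : 0 <= c by apply: integral_ge0 => y _; exact: pc.2.
(* An infinite cost makes the bound trivial, W1 being nonnegative; a finite one can be subtracted,
   which allows a comparison with one coupling at a time. *)
have [->|cfin] := eqVneq c +oo.
  by rewrite addye ?leey// gt_eqF// (lt_le_trans _ (W1_ge0 _ _)).
have {}cfin : c \is a fin_num by rewrite ge0_fin_numE// lt_neqAle cfin leey.
rewrite -leeBlDl//; apply: le_ereal_inf_tmp => _ [pi cpi <-].
rewrite leeBlDl//; have [pi' cpi' piE] := glue _ cpi.
apply: (@le_trans _ _ (\int[pi']_z (dist z.1 z.2)%:E)).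
  by apply: ereal_inf_lbound; exists pi'.
rewrite piE; last exact: pos_measurable_dist.
rewrite /c -(coupling_fst cpi)// -pos_intD//; last 2 first.
- exact: pos_measurable_comp pc _.
- exact: pos_measurable_dist.
apply: pos_le_int => [||[y z]].
- by apply: pG; exact: pos_measurable_dist.
- apply: pos_measurableD; first exact: pos_measurable_comp pc _.
  exact: pos_measurable_dist.
rewrite /G /=.
have pky : pos_measurable (fun x => (k (y, x))%:E).
  by apply: pos_measurable_comp pk _; exact: measurable_fun_pair.
have pkd : pos_measurable (fun x => (k (y, x))%:E * (dist x y)%:E).
  by apply: pos_measurableM => //; exact: pos_measurable_dist_to.
(* The triangle inequality through [y] is applied to the moved mass only. Its second leg and the
   mass at rest then carry the full weight 1 in front of [dist y z]. *)
apply: (@le_trans _ _ ((rho y)%:E * (dist y z)%:E +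
    (\int[lam y]_x ((k (y, x))%:E * (dist x y)%:E) +
     \int[lam y]_x ((dist y z)%:E * (k (y, x))%:E)))).
  rewrite leeD2l// -pos_intD//; last first.
    by apply: pos_measurableM => //; split=> // x; rewrite lee_fin dist_ge0.
  apply: pos_le_int => [||x].
  - by apply: pos_measurableM => //; exact: pos_measurable_dist_to.
  - apply: pos_measurableD => //.
    by apply: pos_measurableM => //; split=> // x; rewrite lee_fin dist_ge0.
  - rewrite [(dist y z)%:E * _]muleC -!EFinM -EFinD lee_fin -mulrDr.
    by apply: ler_wpM2l => //; exact: dist_triangle.
rewrite pos_intZ// ?dist_ge0// addeCA leeD2l// muleC -ge0_muleDr ?lee_fin//.
  by rewrite rhok1 mule1.
by apply: integral_ge0 => x _; rewrite lee_fin.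
Qed.

End metric.

(** * Expectations of bounded functions *)

Section bounded_expectation.
Set Implicit Arguments.
Unset Strict Implicit.
Local Open Scope ring_scope.
Context {R : realType}.

(** Densities with values in [[a, b]], their roots, logarithms and inverses all belong to this
    class, where integrals are real numbers and subtraction is harmless. *)
Definition bdd_measurable d (T : measurableType d) (f : T -> R) : Prop :=
  measurable_fun setT f /\ exists M, forall x, `|f x| <= M.

Section closure.
Context d (T : measurableType d).
Implicit Types f g : T -> R.

Lemma bdd_cst (c : R) : bdd_measurable (fun _ : T => c).
Proof. by split=> //; exists `|c|. Qed.

Lemma bddD f g : bdd_measurable f -> bdd_measurable g ->
  bdd_measurable (fun x => f x + g x).
Proof.
move=> [mf [M fM]] [mg [N gN]]; split; first exact: measurable_funD.
by exists (M + N) => x; rewrite (le_trans (ler_normD _ _))// lerD.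
Qed.

Lemma bddM f g : bdd_measurable f -> bdd_measurable g ->
  bdd_measurable (fun x => f x * g x).
Proof.
move=> [mf [M fM]] [mg [N gN]]; split; first exact: measurable_funM.
by exists (M * N) => x; rewrite normrM ler_pM.
Qed.

Lemma bddN f : bdd_measurable f -> bdd_measurable (fun x => - f x).
Proof.
by move=> [mf [M fM]]; split; [exact: measurable_funN|exists M => x; rewrite normrN].
Qed.

Lemma bddB f g : bdd_measurable f -> bdd_measurable g ->
  bdd_measurable (fun x => f x - g x).
Proof. by move=> bf bg; apply: bddD => //; exact: bddN. Qed.

Lemma bddX f : bdd_measurable f -> bdd_measurable (fun x => f x ^+ 2).
Proof. by move=> bf; apply: bddM. Qed.

Lemma bdd_itv f a b : measurable_fun setT f -> (forall x, a <= f x <= b) ->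
  bdd_measurable f.
Proof.
move=> mf fab; split=> //; exists (`|a| + `|b|) => x; have /andP[] := fab x.
rewrite ler_norml; have := ler_norm b; have := ler_norm (- a); rewrite normrN.
by move=> ha hb h1 h2; apply/andP; split; have := normr_ge0 a; have := normr_ge0 b; lra.
Qed.

Lemma measurable_sqrt_comp f : measurable_fun setT f ->
  measurable_fun setT (fun x => Num.sqrt (f x)).
Proof.
move=> mf; apply: (@measurableT_comp _ _ _ _ _ _ (@Num.sqrt R)) mf.
by apply: continuous_measurable_fun; exact: sqrt_continuous.
Qed.

Lemma bdd_sqrt f a b : measurable_fun setT f -> (forall x, a <= f x <= b) ->
  bdd_measurable (fun x => Num.sqrt (f x)).
Proof.
move=> mf fab; apply: (@bdd_itv _ 0 (Num.sqrt b)); first exact: measurable_sqrt_comp.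
by move=> x; rewrite sqrtr_ge0/= ler_wsqrtr//; have /andP[] := fab x.
Qed.

Lemma bdd_ln f a b : 0 < a -> measurable_fun setT f -> (forall x, a <= f x <= b) ->
  bdd_measurable (fun x => ln (f x)).
Proof.
move=> a0 mf fab; apply: (@bdd_itv _ (ln a) (ln b)).
  exact: measurableT_comp.
move=> x; have /andP[afx fxb] := fab x.
have fx0 : 0 < f x by lra.
by rewrite !ler_ln ?posrE ?afx//; lra.
Qed.

Lemma bdd_inv f a b : 0 < a -> measurable_fun setT f -> (forall x, a <= f x <= b) ->
  bdd_measurable (fun x => (f x)^-1).
Proof.
move=> a0 mf fab; have f0 x : 0 < f x.
  by have /andP[? _] := fab x; exact: lt_le_trans a0 _.
apply: (@bdd_itv _ b^-1 a^-1); last first.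
  move=> x; have /andP[? ?] := fab x.
  by rewrite !lef_pV2 ?posrE//; [apply/andP|exact: lt_le_trans (f0 x) _].
have -> : (fun x => (f x)^-1) = (fun x => expR (- ln (f x))).
  by apply/funext => x; rewrite expRN lnK ?posrE.
apply: measurableT_comp; first exact: measurable_expR.
by apply: measurable_funN; apply: measurableT_comp.
Qed.

End closure.

Lemma bdd_comp d d' (T : measurableType d) (U : measurableType d') (f : U -> R)
    (g : T -> U) : bdd_measurable f -> measurable_fun setT g ->
  bdd_measurable (fun x => f (g x)).
Proof.
by move=> [mf [M fM]] mg; split; [exact: measurableT_comp|exists M].
Qed.

Section expectation.
Context d (T : measurableType d) (P : probability T R).
Implicit Types f g : T -> R.

Lemma bdd_integrable f : bdd_measurable f -> P.-integrable setT (EFin \o f).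
Proof.
move=> [mf [M fM]]; apply: measurable_bounded_integrable => //.
  by apply: (@le_lt_trans _ _ 1%E); [exact: probability_le1|rewrite ltry].
exists M; split; first by rewrite num_real.
by move=> y My x _; rewrite /= (le_trans (fM x))// ltW.
Qed.

Lemma bdd_EFin f : bdd_measurable f ->
  (\int[P]_x f x)%:E = (\int[P]_x (f x)%:E)%E.
Proof.
move=> /bdd_integrable Pf; rewrite /Rintegral fineK//.
exact: integrable_fin_num.
Qed.

Lemma bdd_intD f g : bdd_measurable f -> bdd_measurable g ->
  \int[P]_x (f x + g x) = \int[P]_x f x + \int[P]_x g x.
Proof. by move=> bf bg; rewrite RintegralD//; exact: bdd_integrable. Qed.

Lemma bdd_intB f g : bdd_measurable f -> bdd_measurable g ->
  \int[P]_x (f x - g x) = \int[P]_x f x - \int[P]_x g x.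
Proof. by move=> bf bg; rewrite RintegralB//; exact: bdd_integrable. Qed.

Lemma bdd_intZ c f : bdd_measurable f ->
  \int[P]_x (c * f x) = c * \int[P]_x f x.
Proof. by move=> bf; rewrite RintegralZl//; exact: bdd_integrable. Qed.

Lemma prob_int_cst (c : R) : \int[P]_x c = c.
Proof.
rewrite (Rintegral_cst P measurableT) (_ : fine _ = 1) ?mulr1//.
by rewrite -[RHS]/(fine 1%E); congr fine; exact: probability_setT.
Qed.

Lemma bdd_int_le f g : bdd_measurable f -> bdd_measurable g ->
  (forall x, f x <= g x) -> \int[P]_x f x <= \int[P]_x g x.
Proof.
by move=> bf bg fg; apply: le_Rintegral => //; exact: bdd_integrable.
Qed.

(** Adding a bound makes a function nonnegative; this carries identities known for [pos_measurable]
    functions over to bounded functions of any sign. *)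
Lemma bdd_int_shift f M : bdd_measurable f ->
  \int[P]_x f x = fine (\int[P]_x (f x + M)%:E)%E - M.
Proof.
move=> bf; have := bdd_intD bf (bdd_cst T M); rewrite prob_int_cst /Rintegral => ->.
by rewrite addrK.
Qed.

(** Nonnegativity of the variance. *)
Lemma bdd_sqr_int_le f : bdd_measurable f ->
  (\int[P]_x f x) ^+ 2 <= \int[P]_x (f x ^+ 2).
Proof.
move=> bf; set c := \int[P]_x f x.
have : 0 <= \int[P]_x ((f x - c) ^+ 2) by apply: Rintegral_ge0 => x _; exact: sqr_ge0.
have -> : \int[P]_x ((f x - c) ^+ 2) = \int[P]_x ((f x ^+ 2 - (2 * c) * f x) + c ^+ 2).
  by apply: eq_Rintegral => x _; ring.
rewrite bdd_intD//; last 2 first.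
- by apply: bddB; [exact: bddX|apply: bddM => //; exact: bdd_cst].
- exact: bdd_cst.
rewrite bdd_intB//; last 2 first.
- exact: bddX.
- by apply: bddM => //; exact: bdd_cst.
by rewrite bdd_intZ// prob_int_cst -/c; lra.
Qed.

End expectation.

End bounded_expectation.

(** * The joint law of a step and its symmetry *)

Section kernel_probability.
Set Implicit Arguments.
Unset Strict Implicit.
Context d d' (T : measurableType d) (U : measurableType d') (R : realType)
  (k : R.-pker T ~> U).

(** The value of a kernel is typed as a plain measure; this copy carries the structure of a
    probability, so that the expectation lemmas apply to it. *)
Definition kprob (x : T) : set U -> \bar R := k x.

HB.instance Definition _ x := Measure.on (kprob x).

HB.instance Definition _ x :=
  Measure_isProbability.Build _ _ _ (kprob x) (prob_kernel x).

End kernel_probability.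

Section joint.
Set Implicit Arguments.
Unset Strict Implicit.
Local Open Scope ring_scope.
Context {R : realType} d (X : measurableType d).
Variables (m : R.-pker X ~> X) (nu : probability X R).
Variable G : probability (X * X)%type R.
Hypothesis GE : forall f, pos_measurable f ->
  (\int[G]_z f z = \int[nu]_x \int[m x]_y f (x, y))%E.
Hypothesis rev : reversible_measure m nu.
Implicit Types F : X * X -> R.

(** Reversibility states that [G] and its image under the exchange of coordinates agree on
    measurable sets, hence they have the same integrals. *)
Lemma joint_swap (f : X * X -> \bar R) : pos_measurable f ->
  (\int[G]_z f (z.2, z.1) = \int[G]_z f z)%E.
Proof.
move=> pf.
have mswap : measurable_fun setT (fun z : X * X => (z.2, z.1)).
  exact: measurable_fun_pair.
have GmeasE C : measurable C -> G C = (\int[nu]_x m x [set y | C (x, y)])%E.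
  move=> mC; have := GE (pos_measurable_indic mC).
  rewrite integral_indic// setIT => ->; apply: eq_integral => x _.
  rewrite (_ : (fun y => (\1_C (x, y))%:E) = (fun y => (\1_[set y | C (x, y)] y)%:E)).
    rewrite integral_indic ?setIT//.
    have := @measurable_xsection _ _ _ _ _ x mC.
    by rewrite xsectionE.
  by apply/funext => y; rewrite !indicE; congr (_%:R%:E); apply/idP/idP; rewrite !inE.
transitivity (\int[pushforward G (fun z : X * X => (z.2, z.1))]_z f z)%E.
  by rewrite ge0_integral_pushforward//; [exact: pf.1|move=> z _; exact: pf.2].
apply: eq_measure_integral => C mC _.
have mC' : measurable ((fun z : X * X => (z.2, z.1)) @^-1` C).
  by rewrite -[X in measurable X]setTI; exact: mswap.
transitivity (G ((fun z : X * X => (z.2, z.1)) @^-1` C)) => //.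
exact: etrans (GmeasE _ mC') (etrans (esym (rev mC)) (esym (GmeasE _ mC))).
Qed.

Lemma bdd_joint_swap F : bdd_measurable F ->
  \int[G]_z F (z.2, z.1) = \int[G]_z F z.
Proof.
move=> bF; have [mF [M FM]] := bF.
have mswap : measurable_fun setT (fun z : X * X => (z.2, z.1)).
  exact: measurable_fun_pair.
rewrite (bdd_int_shift _ M bF) (bdd_int_shift _ M (bdd_comp bF mswap)).
congr (fine _ - _); apply: (@joint_swap (fun z => (F z + M)%:E)).
apply: pos_measurable_EFin => [|z]; first exact: measurable_funD.
by have := FM z; rewrite ler_norml; lra.
Qed.

Lemma bdd_section F x : bdd_measurable F -> bdd_measurable (fun y => F (x, y)).
Proof. by move=> bF; apply: bdd_comp bF _. Qed.

Lemma bdd_kernel_int F : bdd_measurable F ->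
  bdd_measurable (fun x => \int[kprob m x]_y F (x, y)).
Proof.
move=> bF; have [mF [M FM]] := bF.
have FM1 z : - M <= F z <= M by have := FM z; rewrite ler_norml.
apply: (@bdd_itv _ _ _ _ (- M) M); last first.
  move=> x; rewrite -{1}(prob_int_cst (kprob m x) (- M)) -{2}(prob_int_cst (kprob m x) M).
  apply/andP; split; apply: bdd_int_le => [||y]; try exact: bdd_cst;
    try exact: bdd_section; by have /andP[] := FM1 (x, y).
have -> : (fun x => \int[kprob m x]_y F (x, y)) =
    (fun x => fine (\int[kprob m x]_y (F (x, y) + M)%:E)%E - M).
  by apply/funext => x; apply: bdd_int_shift; exact: bdd_section.
apply: measurable_funB => //; apply: measurableT_comp => //.
have [] // := @pos_measurable_kernel _ _ _ _ _ m (fun z => (F z + M)%:E).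
apply: pos_measurable_EFin => [|z]; first exact: measurable_funD.
by have := FM1 z; lra.
Qed.

Lemma bdd_jointE F : bdd_measurable F ->
  \int[G]_z F z = \int[nu]_x \int[kprob m x]_y F (x, y).
Proof.
move=> bF; have [mF [M FM]] := bF.
have pF : pos_measurable (fun z => (F z + M)%:E).
  apply: pos_measurable_EFin => [|z]; first exact: measurable_funD.
  by have := FM z; rewrite ler_norml; lra.
rewrite (bdd_int_shift _ M bF) (bdd_int_shift _ M (bdd_kernel_int bF)).
rewrite (GE pF); congr (fine _ - _); apply: eq_integral => x _.
rewrite EFinD bdd_EFin; last exact: bdd_section.
rewrite -[in RHS](prob_int_cst (kprob m x) M) bdd_EFin; last exact: bdd_cst.
rewrite -integralD//=; last 2 first.
- by apply: bdd_integrable; exact: bdd_section.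
- by apply: bdd_integrable; exact: bdd_cst.
Qed.

End joint.

(** * One step of the discrete heat flow *)

Section heat_step.
Set Implicit Arguments.
Unset Strict Implicit.
Local Open Scope ring_scope.
Context {R : realType} {d : measure_display} {X : measurableType d}.
Variables (m : R.-pker X ~> X) (nu : probability X R).
Variable G : probability (X * X)%type R.
Hypothesis GE : forall f, pos_measurable f ->
  (\int[G]_z f z = \int[nu]_x \int[m x]_y f (x, y))%E.
Hypothesis rev : reversible_measure m nu.
Implicit Types f : X -> R.

Definition average f x := \int[kprob m x]_y f y.

Definition heat e f x := (1 - e) * f x + e * average f x.

(* This is [I_nu (f nu)] when [G] is the measure [m_x(dy) nu(dx)]. *)
Definition sqrt_energy f :=
  \int[G]_z ((Num.sqrt (f z.2) - Num.sqrt (f z.1)) ^+ 2).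

Definition entropy f := \int[nu]_x (f x * ln (f x)).

Section step.
Variables (f : X -> R) (a b e : R).
Hypothesis a0 : 0 < a.
Hypothesis mf : measurable_fun setT f.
Hypothesis fab : forall x, a <= f x <= b.
Hypothesis e0 : 0 < e.
Hypothesis e1 : e < 1.

Let bf : bdd_measurable f. Proof. exact: bdd_itv mf fab. Qed.

Let bf1 : bdd_measurable (fun z : X * X => f z.1).
Proof. by apply: bdd_comp bf _. Qed.

Let bf2 : bdd_measurable (fun z : X * X => f z.2).
Proof. by apply: bdd_comp bf _. Qed.

Let f0 x : 0 < f x. Proof. by have /andP[? ?] := fab x; apply: lt_le_trans a0 _. Qed.

Let bavg : bdd_measurable (average f).
Proof. exact: (@bdd_kernel_int _ _ _ m (fun z => f z.2)). Qed.

Lemma average_itv x : a <= average f x <= b.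
Proof.
apply/andP; split.
  rewrite -(prob_int_cst (kprob m x) a); apply: bdd_int_le => // [|y].
    exact: bdd_cst.
  by have /andP[] := fab y.
rewrite -(prob_int_cst (kprob m x) b); apply: bdd_int_le => // [|y].
  exact: bdd_cst.
by have /andP[] := fab y.
Qed.

Lemma heat_itv x : a <= heat e f x <= b.
Proof.
have /andP[af fb] := fab x; have /andP[aM Mb] := average_itv x.
have e'0 : 0 <= 1 - e by rewrite subr_ge0 ltW.
have := ler_wpM2l e'0 af; have := ler_wpM2l e'0 fb.
have := ler_wpM2l (ltW e0) aM; have := ler_wpM2l (ltW e0) Mb.
by rewrite /heat => ? ? ? ?; apply/andP; split; lra.
Qed.

Let bheat : bdd_measurable (heat e f).
Proof.
apply: bddD; apply: bddM => //; exact: bdd_cst.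
Qed.

Lemma measurable_heat : measurable_fun setT (heat e f).
Proof. by have [] := bheat. Qed.

Lemma average_mass : \int[nu]_x average f x = \int[nu]_x f x.
Proof.
transitivity (\int[G]_z f z.2).
  by rewrite (bdd_jointE GE bf2).
rewrite -(bdd_joint_swap GE rev bf2) (bdd_jointE GE); last exact: bf1.
by apply: eq_Rintegral => x _; rewrite /= prob_int_cst.
Qed.

Lemma heat_mass : \int[nu]_x heat e f x = \int[nu]_x f x.
Proof.
rewrite /heat bdd_intD; last 2 first.
- by apply: bddM => //; exact: bdd_cst.
- by apply: bddM => //; exact: bdd_cst.
by rewrite !bdd_intZ// average_mass; ring.
Qed.

Let bln : bdd_measurable (fun x => ln (f x)).
Proof. exact: bdd_ln a0 mf fab. Qed.

Let bsqrt : bdd_measurable (fun x => Num.sqrt (f x)).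
Proof. exact: bdd_sqrt mf fab. Qed.

Let bJ : bdd_measurable (fun z : X * X =>
  (Num.sqrt (f z.2) - Num.sqrt (f z.1)) ^+ 2).
Proof. by apply: bddX; apply: bddB; apply: bdd_comp bsqrt _. Qed.

Lemma sqrt_energy_ge0 : 0 <= sqrt_energy f.
Proof. by apply: Rintegral_ge0 => z _; exact: sqr_ge0. Qed.

Let sub_average x : average f x - f x = \int[kprob m x]_y (f y - f x).
Proof. by rewrite bdd_intB ?prob_int_cst//; exact: bdd_cst. Qed.

(** Symmetrization: adding the integrand [F] to its image under the exchange cancels the 1 and
    leaves [- (f y - f x) (ln f y - ln f x)], to which [ln_sqrt_gap] applies. Halving its constant 4
    gives 2. *)
Lemma entropy_production :
  \int[nu]_x ((average f x - f x) * (1 + ln (f x))) <= - 2 * sqrt_energy f.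
Proof.
pose F z := (f z.2 - f z.1) * (1 + ln (f z.1)).
have bln1 : bdd_measurable (fun z : X * X => 1 + ln (f z.1)).
  by apply: bddD; [exact: bdd_cst|apply: bdd_comp bln _].
have bln2 : bdd_measurable (fun z : X * X => 1 + ln (f z.2)).
  by apply: bddD; [exact: bdd_cst|apply: bdd_comp bln _].
have bF : bdd_measurable F by apply: bddM => //; exact: bddB.
have bFs : bdd_measurable (fun z => F (z.2, z.1)) by apply: bddM => //; exact: bddB.
have -> : \int[nu]_x ((average f x - f x) * (1 + ln (f x))) = \int[G]_z F z.
  rewrite (bdd_jointE GE bF); apply: eq_Rintegral => x _.
  rewrite sub_average mulrC -bdd_intZ; last by apply: bddB => //; exact: bdd_cst.
  by apply: eq_Rintegral => y _; rewrite /F /= mulrC.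
have sF : \int[G]_z F z + \int[G]_z F z <= - 4 * sqrt_energy f.
  rewrite -{1}(bdd_joint_swap GE rev bF) -bdd_intD// -bdd_intZ//.
  apply: bdd_int_le => [||z].
  - exact: bddD.
  - by apply: bddM => //; exact: bdd_cst.
  - by rewrite /F /=; have := ln_sqrt_gap (f0 z.2) (f0 z.1); lra.
lra.
Qed.

(** Jensen's inequality under each [m x], then [|f y - f x| <= 2 sqrt b |sqrt (f y) - sqrt (f x)|].
    A bound by the energy itself is what keeps the second-order error proportional to the gain. *)
Lemma average_sqr_dev :
  \int[nu]_x ((average f x - f x) ^+ 2) <= 4 * b * sqrt_energy f.
Proof.
have bD : bdd_measurable (fun z : X * X => (f z.2 - f z.1) ^+ 2).
  by apply: bddX; exact: bddB.
apply: (@le_trans _ _ (\int[G]_z ((f z.2 - f z.1) ^+ 2))).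
  rewrite (bdd_jointE GE bD); apply: bdd_int_le => [||x].
  - by apply: bddX; exact: bddB.
  - exact: (bdd_kernel_int m bD).
  - rewrite sub_average; apply: bdd_sqr_int_le.
    by apply: bddB => //; exact: bdd_cst.
rewrite -bdd_intZ//; apply: bdd_int_le => [||z] //.
  by apply: bddM => //; exact: bdd_cst.
have /andP[? ?] := fab z.1; have /andP[? ?] := fab z.2.
by apply: sqr_sub_sqrt => //; exact: ltW.
Qed.

(** Integrate [xlnx_taylor] with increment [e (average f - f)]. The linear term is the entropy
    production, and the quadratic one, at most [4 b e^2 / a] times the energy, is the fraction
    [2 e b / a] of it. *)
Lemma entropy_step :
  entropy (heat e f) <= entropy f - 2 * e * sqrt_energy f * (1 - 2 * e * b / a).
Proof.
have bent : bdd_measurable (fun x => f x * ln (f x)) by exact: bddM.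
have bentp : bdd_measurable (fun x => (average f x - f x) * (1 + ln (f x))).
  by apply: bddM; [exact: bddB|apply: bddD => //; exact: bdd_cst].
have bsq : bdd_measurable (fun x => (average f x - f x) ^+ 2).
  by apply: bddX; exact: bddB.
have bc (c : R) g : bdd_measurable g -> bdd_measurable (fun x : X => c * g x).
  by move=> bg; apply: bddM => //; exact: bdd_cst.
have : entropy (heat e f) <= \int[nu]_x (f x * ln (f x) +
    (e * ((average f x - f x) * (1 + ln (f x))) +
     e ^+ 2 / a * (average f x - f x) ^+ 2)).
  apply: bdd_int_le => [||x].
  - apply: bddM => //.
    by apply: (@bdd_ln _ _ _ _ a b) => //; [exact: measurable_heat|exact: heat_itv].
  - by apply: bddD => //; apply: bddD; exact: bc.
  - have /andP[af _] := fab x; have /andP[ah _] := heat_itv x.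
    apply: le_trans (xlnx_taylor a0 af (lt_le_trans a0 ah)) _.
    have -> : heat e f x - f x = e * (average f x - f x) by rewrite /heat; ring.
    rewrite le_eqVlt; apply/orP; left; apply/eqP; field; exact: lt0r_neq0.
rewrite bdd_intD//; last by apply: bddD; exact: bc.
rewrite bdd_intD; [|exact: bc|exact: bc].
rewrite !bdd_intZ// -/(entropy f) => /le_trans; apply.
have h1 := @ler_wpM2l _ e (ltW e0) _ _ entropy_production.
have ea : 0 <= e ^+ 2 / a by rewrite divr_ge0 ?sqr_ge0// ltW.
have h2 := @ler_wpM2l _ _ ea _ _ average_sqr_dev.
have -> : 2 * e * sqrt_energy f * (1 - 2 * e * b / a) =
  2 * e * sqrt_energy f - e ^+ 2 / a * (4 * b * sqrt_energy f) by field; exact: lt0r_neq0.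
lra.
Qed.

End step.
End heat_step.

(** * Transport cost of one heat step *)

Section heat_transport.
Set Implicit Arguments.
Unset Strict Implicit.
Local Open Scope ring_scope.
Context {R : realType} {d : measure_display} {X : measurableType d}.
Variable dist : X -> X -> R.
Hypothesis polish : polish_metric dist.
Hypothesis borel : borel_of_metric dist.
Variables (m : R.-pker X ~> X) (nu : probability X R).
Variable G : probability (X * X)%type R.
Hypothesis GE : forall f, pos_measurable f ->
  (\int[G]_z f z = \int[nu]_x \int[m x]_y f (x, y))%E.
Hypothesis rev : reversible_measure m nu.
Variable th : R.
Hypothesis thE : {ae nu, forall x,
  (\int[m x]_y ((dist x y) ^+ 2)%:E <= (2 * th)%:E)%E}.

Lemma theta_ge0 : 0 <= th.
Proof.
have [N [mN N0 NE]] := thE.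
have [x Nx] : exists x, ~ N x.
  apply/existsNP => NT; have NTE : N = setT by apply/seteqP; split.
  have : nu setT = 1%E by exact: probability_setT.
  by rewrite -NTE N0 => /eqP; rewrite eqe eq_sym oner_eq0.
have : (\int[m x]_y ((dist x y) ^+ 2)%:E <= (2 * th)%:E)%E.
  by apply: contrapT => H; apply: Nx; exact: NE.
have : (0 <= \int[m x]_y ((dist x y) ^+ 2)%:E)%E.
  by apply: integral_ge0 => y _; rewrite lee_fin sqr_ge0.
by move=> /le_trans /[apply]; rewrite lee_fin pmulr_rge0.
Qed.

Variables (f : X -> R) (a b e : R).
Hypothesis a0 : 0 < a.
Hypothesis mf : measurable_fun setT f.
Hypothesis fab : forall x, a <= f x <= b.
Hypothesis f1 : \int[nu]_x f x = 1.
Hypothesis e0 : 0 < e.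
Hypothesis e1 : e < 1.

Let f0 x : 0 < f x. Proof. by have /andP[? _] := fab x; exact: lt_le_trans a0 _. Qed.

Let bf : bdd_measurable f. Proof. exact: bdd_itv mf fab. Qed.

Let bf1 : bdd_measurable (fun z : X * X => f z.1).
Proof. by apply: bdd_comp bf _. Qed.

Let bf2 : bdd_measurable (fun z : X * X => f z.2).
Proof. by apply: bdd_comp bf _. Qed.

Let pdist2 : pos_measurable (fun z : X * X => ((dist z.1 z.2) ^+ 2)%:E).
Proof.
apply: pos_measurable_EFin => [|z]; last exact: sqr_ge0.
by apply: measurable_funX; exact: measurable_dist.
Qed.

Let pf1 : pos_measurable (fun z : X * X => (f z.1)%:E).
Proof. by apply: pos_measurable_EFin => [|z]; [exact: bf1.1|exact: ltW]. Qed.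

Let pf2 : pos_measurable (fun z : X * X => (f z.2)%:E).
Proof. by apply: pos_measurable_EFin => [|z]; [exact: bf2.1|exact: ltW]. Qed.

(** The mass 1 of [f] makes the bound independent of [f]. *)
Let energy1 : (\int[G]_z ((f z.1)%:E * ((dist z.1 z.2) ^+ 2)%:E) <= (2 * th)%:E)%E.
Proof.
have pf : pos_measurable (fun x => (f x)%:E).
  by apply: pos_measurable_EFin => [|x]; [exact: bf.1|exact: ltW].
rewrite GE; last exact: pos_measurableM.
apply: (@le_trans _ _ (\int[nu]_x ((f x)%:E * (2 * th)%:E))%E); last first.
  under eq_integral do rewrite muleC.
  rewrite integralZl//; last exact: bdd_integrable.
  by rewrite -bdd_EFin// f1 mule1.
have th0 : 0 <= 2 * th by rewrite mulr_ge0//; exact: theta_ge0.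
apply: ae_ge0_le_integral => //.
- move=> x _; apply: integral_ge0 => y _.
  by rewrite -EFinM lee_fin mulr_ge0 ?sqr_ge0// ltW.
- have [] // := @pos_measurable_kernel _ _ _ _ _ m
    (fun z => (f z.1)%:E * ((dist z.1 z.2) ^+ 2)%:E)%E.
  exact: pos_measurableM.
- by move=> x _; rewrite -EFinM lee_fin mulr_ge0// ltW.
- by apply/measurable_EFinP; exact: measurable_funM.
apply: filterS thE => x H _.
rewrite /= pos_intZ//; [|exact: ltW|].
  by apply: lee_wpmul2l => //; rewrite lee_fin ltW.
apply: (@pos_measurable_comp _ _ _ _ _ _ (fun y => (x, y)) pdist2).
exact: measurable_fun_pair.
Qed.

(* Moving only the net flow between two points makes the cost of a step depend
   on [f x - f y] instead of [f x]. *)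
Let flux (z : X * X) := e * Num.max (f z.2 - f z.1) 0.

Let bflux : bdd_measurable flux.
Proof.
apply: bddM; first exact: bdd_cst.
apply: (@bdd_itv _ _ _ _ 0 (b - a)).
  by apply: measurable_maxr => //; exact: (bddB bf2 bf1).1.
move=> z; have /andP[? ?] := fab z.1; have /andP[? ?] := fab z.2.
rewrite le_max lexx orbT /= ge_max; apply/andP; split; lra.
Qed.

Let flux_ge0 z : 0 <= flux z.
Proof. by apply: mulr_ge0; [exact: ltW|rewrite le_max lexx orbT]. Qed.

Let pflux : pos_measurable (fun z => (flux z)%:E).
Proof. exact: pos_measurable_EFin bflux.1 flux_ge0. Qed.

Let pdist := pos_measurable_dist polish borel.

Let cost := (\int[G]_z ((flux z)%:E * (dist z.2 z.1)%:E))%E.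

(** Doubling the cost by the exchange of coordinates makes the flows in both directions appear, so
    that [flux_young] can be integrated; its parameter is then optimized. *)
Let cost_le :
  (cost <= (e * Num.sqrt (2 * th * sqrt_energy G f))%:E)%E.
Proof.
pose J := sqrt_energy G f.
have J0 : 0 <= J by exact: sqrt_energy_ge0.
have bsqrt := bdd_sqrt mf fab.
have bJ : bdd_measurable (fun z : X * X =>
    (Num.sqrt (f z.2) - Num.sqrt (f z.1)) ^+ 2).
  by apply: bddX; apply: bddB; apply: bdd_comp bsqrt _.
have pJ : pos_measurable (fun z : X * X =>
    ((Num.sqrt (f z.2) - Num.sqrt (f z.1)) ^+ 2)%:E).
  by apply: pos_measurable_EFin => [|z]; [exact: bJ.1|exact: sqr_ge0].
have pfd : pos_measurable (fun z : X * X => (flux z)%:E * (dist z.2 z.1)%:E)%E.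
  apply: pos_measurableM => //.
  by under eq_fun do rewrite (dist_sym polish).
have pfds : pos_measurable (fun z : X * X => (flux (z.2, z.1))%:E * (dist z.1 z.2)%:E)%E.
  apply: pos_measurableM => //.
  by apply: pos_measurable_comp pflux _; exact: measurable_fun_pair.
have pE1 : pos_measurable (fun z : X * X => (f z.1)%:E * ((dist z.1 z.2) ^+ 2)%:E)%E.
  exact: pos_measurableM.
have pE2 : pos_measurable (fun z : X * X => (f z.2)%:E * ((dist z.1 z.2) ^+ 2)%:E)%E.
  exact: pos_measurableM.
have energy2 : (\int[G]_z ((f z.2)%:E * ((dist z.1 z.2) ^+ 2)%:E) <= (2 * th)%:E)%E.
  rewrite -(joint_swap GE rev pE2) /=.
  by under eq_integral do rewrite (dist_sym polish).
have cst_pos (c : R) (g : X * X -> \bar R) : 0 <= c -> pos_measurable g ->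
    pos_measurable (fun z => c%:E * g z)%E.
  by move=> c0 pg; apply: pos_measurableM => //; split=> // z; rewrite lee_fin.
have young s : 0 < s ->
    (cost + cost <= (e * (s / 2 * J + 4 * th / s))%:E)%E.
  move=> s0.
  have es0 : 0 <= e / s by rewrite divr_ge0// ltW.
  have es1 : 0 <= e * (s / 2) by rewrite mulr_ge0 ?ltW// divr_gt0.
  rewrite /cost -{1}(joint_swap GE rev pfd) /= -pos_intD//.
  apply: (@le_trans _ _ (\int[G]_z ((e * (s / 2))%:E *
      ((Num.sqrt (f z.2) - Num.sqrt (f z.1)) ^+ 2)%:E +
      ((e / s)%:E * ((f z.1)%:E * ((dist z.1 z.2) ^+ 2)%:E)
       + (e / s)%:E * ((f z.2)%:E * ((dist z.1 z.2) ^+ 2)%:E))))%E).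
    apply: pos_le_int => [||[x y]].
    - exact: pos_measurableD.
    - by apply: pos_measurableD; [exact: cst_pos|
        apply: pos_measurableD; exact: cst_pos].
    - rewrite -!EFinM -!EFinD lee_fin /flux/= (dist_sym polish y x).
      have := flux_young e0 s0 (sqrtr_ge0 (f x)) (sqrtr_ge0 (f y)) (dist_ge0 polish x y).
      by rewrite !sqr_sqrtr ?(ltW (f0 _)).
  rewrite pos_intD; [|exact: cst_pos|by apply: pos_measurableD; exact: cst_pos].
  rewrite pos_intD; [|exact: cst_pos|exact: cst_pos].
  rewrite !pos_intZ// -bdd_EFin// -/(sqrt_energy G f) -/J.
  have -> : e * (s / 2 * J + 4 * th / s) =
      e * (s / 2) * J + (e / s * (2 * th) + e / s * (2 * th)).
    by field; exact: lt0r_neq0.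
  rewrite !EFinD -EFinM leeD2l// (EFinM (e / s) (2 * th)).
  by apply: leeD; apply: lee_wpmul2l; rewrite ?lee_fin.
have cost0 : (0 <= cost)%E by apply: integral_ge0 => z _; exact: pfd.2.
have costfin : cost \is a fin_num.
  rewrite ge0_fin_numE//; apply: (@le_lt_trans _ _ (cost + cost)%E).
    by rewrite leeDl.
  by apply: le_lt_trans (young 1 ltr01) _; rewrite ltry.
rewrite -(fineK costfin) lee_fin.
(* Half of the bound [young], divided by [e], is [s A + B / s] with [A = J / 4] and [B = 2 th]. *)
have -> : e * Num.sqrt (2 * th * J) = e * (2 * Num.sqrt (J / 4 * (2 * th))).
  have -> : 2 * th * J = 2 ^+ 2 * (J / 4 * (2 * th)) by field.
  by rewrite sqrtrM ?sqr_ge0// sqrtr_sqr ger0_norm.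
rewrite -ler_pdivrMl//; apply: le_2sqrt_of_young.
- by rewrite divr_ge0.
- by rewrite mulr_ge0//; exact: theta_ge0.
move=> s s0; have := young s s0; rewrite -(fineK costfin) -EFinD lee_fin => h.
rewrite ler_pdivrMl//.
have -> : e * (s * (J / 4) + 2 * th / s) = e * (s / 2 * J + 4 * th / s) / 2.
  by field; exact: lt0r_neq0.
lra.
Qed.

Let bheat : bdd_measurable (heat m e f).
Proof. exact: bdd_itv (measurable_heat m e mf fab) (heat_itv m mf fab e0 e1). Qed.

Let heat0 x : 0 < heat m e f x.
Proof. by have /andP[? _] := heat_itv m mf fab e0 e1 x; exact: lt_le_trans a0 _. Qed.

Let bheatV : bdd_measurable (fun x => (heat m e f x)^-1).
Proof.
exact: bdd_inv a0 (measurable_heat m e mf fab) (heat_itv m mf fab e0 e1).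
Qed.

Let loss y := \int[kprob m y]_x Num.max (f y - f x) 0.

Let bpos : bdd_measurable (fun z : X * X => Num.max (f z.1 - f z.2) 0).
Proof.
apply: (@bdd_itv _ _ _ _ 0 (b - a)).
  by apply: measurable_maxr => //; exact: (bddB bf1 bf2).1.
move=> z; have /andP[? ?] := fab z.1; have /andP[? ?] := fab z.2.
rewrite le_max lexx orbT /= ge_max; apply/andP; split; lra.
Qed.

Let bloss : bdd_measurable loss.
Proof. exact: (bdd_kernel_int m bpos). Qed.

Let loss_le y : loss y <= f y.
Proof.
rewrite -[leRHS](prob_int_cst (kprob m y)); apply: bdd_int_le => [||x].
- exact: (bdd_section y bpos).
- exact: bdd_cst.
- by rewrite ge_max; apply/andP; split; [have := f0 x; lra|exact: ltW].
Qed.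

(** Mass balance at [y]: what stays plus what arrives. It rests on [max t 0 - max (- t) 0 = t]. *)
Let heat_gain y : f y - e * loss y + \int[kprob m y]_x flux (y, x) = heat m e f y.
Proof.
have bl : bdd_measurable (fun x => e * Num.max (f y - f x) 0).
  by apply: bddM; [exact: bdd_cst|exact: (bdd_section y bpos)].
have bfl := bdd_section y bflux.
rewrite /loss -bdd_intZ; last exact: (bdd_section y bpos).
have -> : \int[kprob m y]_x flux (y, x) =
    \int[kprob m y]_x (e * (f x - f y) + e * Num.max (f y - f x) 0).
  apply: eq_Rintegral => x _; rewrite /flux /= -mulrDr; congr (e * _).
  have [xy|yx] := leP (f x) (f y).
    have -> : Num.max (f x - f y) 0 = 0 by apply/max_idPr; rewrite subr_le0.
    have -> : Num.max (f y - f x) 0 = f y - f x by apply/max_idPl; rewrite subr_ge0.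
    by ring.
  have -> : Num.max (f y - f x) 0 = 0 by apply/max_idPr; rewrite subr_le0 ltW.
  have -> : Num.max (f x - f y) 0 = f x - f y by apply/max_idPl; rewrite subr_ge0 ltW.
  by ring.
have bd : bdd_measurable (fun x => f x - f y) by apply: bddB => //; exact: bdd_cst.
rewrite bdd_intD//; last by apply: bddM => //; exact: bdd_cst.
rewrite (bdd_intZ _ e bd) bdd_intB//; last exact: bdd_cst.
by rewrite prob_int_cst /heat /average; ring.
Qed.

(** The step is undone, from [mu'] back to [mu]: of the new mass at [y], the share [rho y] was
    already there and the share [k (y, x)] had come from [x]. *)
Lemma W1_heat_step (mu mu' : probability X R) :
  density nu mu f -> density nu mu' (heat m e f) ->
  (W1 dist mu nu <=
    (e * Num.sqrt (2 * th * sqrt_energy G f))%:E + W1 dist mu' nu)%E.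
Proof.
move=> dmu dmu'.
pose rho y := (f y - e * loss y) / heat m e f y.
pose k (z : X * X) := flux z / heat m e f z.1.
have brho : bdd_measurable rho.
  by apply: bddM => //; apply: bddB => //; apply: bddM => //; exact: bdd_cst.
have bk : bdd_measurable k by apply: bddM => //; apply: bdd_comp bheatV _.
have rho0 y : 0 <= rho y.
  rewrite divr_ge0 ?(ltW (heat0 _))// subr_ge0.
  apply: le_trans (loss_le y); rewrite -[leRHS]mul1r ler_wpM2r ?(ltW e1)//.
  by apply: Rintegral_ge0 => x _; rewrite le_max lexx orbT.
have k0 z : 0 <= k z by rewrite divr_ge0 ?(ltW (heat0 _)).
have prho := pos_measurable_EFin brho.1 rho0.
have pk := pos_measurable_EFin bk.1 k0.
have pint (g : X * X -> R) y : bdd_measurable g ->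
    (\int[m y]_x (g (y, x))%:E = (\int[kprob m y]_x g (y, x))%:E)%E.
  by move=> bg; rewrite bdd_EFin//; exact: (bdd_section y bg).
have heatk y x : heat m e f y * k (y, x) = flux (y, x).
  by rewrite mulrC divfK// lt0r_neq0.
have ker1 y : ((rho y)%:E + \int[m y]_x (k (y, x))%:E = 1)%E.
  rewrite pint// -EFinD; congr EFin.
  apply: (mulfI (lt0r_neq0 (heat0 y))); rewrite mulr1 mulrDr -bdd_intZ; last first.
    exact: (bdd_section y bk).
  under eq_Rintegral do rewrite heatk.
  by rewrite /rho mulrC divfK ?lt0r_neq0// heat_gain.
have lawE A : measurable A -> (mu A =
    \int[mu']_y ((rho y)%:E * (\1_A y)%:E
      + \int[m y]_x ((k (y, x))%:E * (\1_A x)%:E)))%E.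
  move=> mA.
  have bA : bdd_measurable (\1_A : X -> R).
    apply: (@bdd_itv _ _ _ _ 0 1) => [|x]; first exact: measurable_indic.
    by rewrite indicE; case: (x \in A); rewrite /= ?lexx ler01.
  have bA2 : bdd_measurable (fun z : X * X => \1_A z.2 : R) by apply: bdd_comp bA _.
  have bA1 : bdd_measurable (fun z : X * X => \1_A z.1 : R) by apply: bdd_comp bA _.
  have bkA : bdd_measurable (fun z : X * X => k z * \1_A z.2) by exact: bddM.
  have bfA : bdd_measurable (fun z : X * X => flux z * \1_A z.2) by exact: bddM.
  have bfluxs : bdd_measurable (fun z : X * X => flux (z.2, z.1)).
    by apply: bdd_comp bflux _; exact: measurable_fun_pair.
  have bfs : bdd_measurable (fun z : X * X => flux (z.2, z.1) * \1_A z.1) by exact: bddM.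
  have pkA : pos_measurable (fun z : X * X => (k z * \1_A z.2)%:E).
    by apply: pos_measurable_EFin => [|z]; [exact: bkA.1|rewrite mulr_ge0].
  have bloss' : bdd_measurable (fun y => (f y - e * loss y) * \1_A y).
    by apply: bddM => //; apply: bddB => //; apply: bddM => //; exact: bdd_cst.
  rewrite (density_integral dmu'); last first.
    apply: pos_measurableD.
      by apply: pos_measurableM => //; exact: pos_measurable_indic.
    by under eq_fun do under eq_integral do rewrite -EFinM;
      exact: (pos_measurable_kernel m pkA).
  transitivity (\int[nu]_y ((f y - e * loss y) * \1_A y +
      \int[kprob m y]_x (flux (y, x) * \1_A x))%:E)%E; last first.
    apply: eq_integral => y _; under [in RHS]eq_integral do rewrite -EFinM.
    rewrite (pint _ y bkA) /= -EFinM; congr EFin.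
    rewrite mulrDr -(bdd_intZ (kprob m y) (heat m e f y) (bdd_section y bkA)) /=.
    congr (_ + _); first by rewrite mulrA /rho [heat _ _ _ _ * _]mulrC divfK// lt0r_neq0.
    by apply: eq_Rintegral => x _; rewrite mulrA heatk.
  have [_ _ ->] := dmu => //; rewrite -int_mul_indic.
  under eq_integral do rewrite -EFinM.
  rewrite -bdd_EFin; last exact: bddM.
  rewrite -bdd_EFin; last by apply: bddD => //; exact: (bdd_kernel_int m bfA).
  congr EFin; rewrite bdd_intD//; last exact: (bdd_kernel_int m bfA).
  (* By reversibility, the mass sent back into [A], summed over its holders, becomes the outflow
     [e * loss] summed over the points of [A]. *)
  rewrite -(bdd_jointE GE bfA) -(bdd_joint_swap GE rev bfA).
  rewrite (bdd_jointE GE bfs) -bdd_intD//; last exact: (bdd_kernel_int m bfs).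
  apply: eq_Rintegral => y _.
  under [X in _ = _ + X]eq_Rintegral do rewrite /= mulrC.
  rewrite bdd_intZ; last exact: (bdd_section y bfluxs).
  rewrite /flux /= bdd_intZ; last exact: (bdd_section y bpos).
  by rewrite -/(loss y); ring.
have pkd : pos_measurable (fun z : X * X => (k z)%:E * (dist z.2 z.1)%:E)%E.
  by apply: pos_measurableM => //; under eq_fun do rewrite (dist_sym polish).
have := W1_glue polish borel nu brho.1 rho0 bk.1 k0 ker1 lawE.
move=> /le_trans; apply; rewrite leeD2r//.
rewrite (density_integral dmu'); last first.
  exact: (pos_measurable_kernel m pkd).
apply: le_trans cost_le; rewrite /cost GE; last first.
  by apply: pos_measurableM => //; under eq_fun do rewrite (dist_sym polish).
rewrite le_eqVlt; apply/orP; left; apply/eqP; apply: eq_integral => y _.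
rewrite -pos_intZ; [|exact: ltW|].
  by apply: eq_integral => x _; rewrite muleA -EFinM heatk.
apply: pos_measurableM; last exact: pos_measurable_dist_to.
apply: (@pos_measurable_comp _ _ _ _ _ _ (fun x => (y, x)) pk).
exact: measurable_fun_pair.
Qed.

End heat_transport.

(** * Densities: existence, uniqueness, mass *)

Section densities.
Set Implicit Arguments.
Unset Strict Implicit.
Context {R : realType} {d : measure_display} {X : measurableType d}.
Variables nu mu : probability X R.

Lemma density_mass f : density nu mu f -> \int[nu]_x (f x)%:E = 1.
Proof.
by move=> [_ _ muE]; apply: etrans (probability_setT mu); apply: esym; exact: muE.
Qed.

Lemma density_dominates f : density nu mu f -> mu `<< nu.
Proof.
move=> [mf f0 muE]; apply/null_content_dominatesP => A mA A0.
apply: etrans (muE A mA) _; apply: null_set_integral => //.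
by apply: measurable_funS (measurableT) (@subsetT _ _) _; exact/measurable_EFinP.
Qed.

Lemma dominated_density : mu `<< nu -> exists f, density nu mu f.
Proof.
move=> munu.
have [f [f0 ffin fint muE]] := @radon_nikodym_sigma_finite _ _ _ nu mu munu.
exists (fine \o f); split=> [|x|A mA].
- by apply: measurableT_comp => //; exact: measurable_int fint.
- by rewrite fine_ge0.
- by apply: etrans (muE A mA) _; apply: eq_integral => x _; rewrite /= fineK.
Qed.

(** [Inu] is defined through a density picked by choice; almost sure uniqueness lets it be computed
    from any other density. *)
Lemma density_unique f g : density nu mu f -> density nu mu g ->
  {ae nu, forall x, f x = g x}.
Proof.
move=> df [mg g0 mugE]; have [mf f0 mufE] := df.
have : ae_eq nu setT (EFin \o f) (EFin \o g).
  apply: integral_ae_eq => //.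
  - apply/integrableP; split; first exact/measurable_EFinP.
    under eq_integral do rewrite /= ger0_norm//.
    by rewrite (density_mass df) ltry.
  - exact/measurable_EFinP.
  - by move=> E _ mE; apply: etrans (esym (mufE _ mE)) (mugE _ mE).
by apply: filterS => x /(_ Logic.I) [].
Qed.

End densities.

(** * The information as an energy of the root of the density *)

Section energy.
Set Implicit Arguments.
Unset Strict Implicit.
Context {R : realType} {d : measure_display} {X : measurableType d}.
Variables (m : R.-pker X ~> X) (nu : probability X R).
Variable G : probability (X * X)%type R.
Hypothesis GE : forall f, pos_measurable f ->
  \int[G]_z f z = \int[nu]_x \int[m x]_y f (x, y).
Hypothesis rev : reversible_measure m nu.

(** The first marginal of [G] is [nu], so a null set spans a null cylinder. The energy involves [f]
    at both ends of a step, whence the companion for the second coordinate. *)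
Lemma joint_ae_fst (P : X -> Prop) :
  {ae nu, forall x, P x} -> {ae G, forall z, P z.1}.
Proof.
move=> [N [mN N0 NP]]; exists (N `*` setT); split.
- exact: measurableX.
- have := GE (pos_measurable_comp (pos_measurable_indic mN) (@measurable_fst _ _ X X)).
  under [X in _ = X]eq_integral do rewrite /= integral_cst// prob_kernel mule1.
  have -> : \int[nu]_x (\1_N x)%:E = 0.
    by rewrite integral_indic// setIT; exact: N0.
  move=> <-.
  apply: etrans (measure_as_integral G (measurableX mN measurableT)) _.
  by apply: eq_integral => z _; rewrite !indicE in_setX in_setT andbT.
- by move=> [x y] /= nP; split => //; exact: NP.
Qed.

Lemma joint_ae_snd (P : X -> Prop) :
  {ae nu, forall x, P x} -> {ae G, forall z, P z.2}.
Proof.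
move=> /joint_ae_fst [N [mN N0 NP]]; exists ((fun z => (z.2, z.1)) @^-1` N).
have mswap : measurable_fun setT (fun z : X * X => (z.2, z.1)).
  exact: measurable_fun_pair.
have mN' : measurable ((fun z : X * X => (z.2, z.1)) @^-1` N).
  by rewrite -[X in measurable X]setTI; exact: mswap.
split=> //; last by move=> z nP; exact: (NP (z.2, z.1)).
have := joint_swap GE rev (pos_measurable_indic mN).
have -> : \int[G]_x (\1_N x)%:E = 0.
  by rewrite integral_indic// setIT; exact: N0.
move=> <-.
exact: etrans (measure_as_integral G mN') _.
Qed.

Let root_gap g (z : X * X) : R := ((Num.sqrt (g z.2) - Num.sqrt (g z.1)) ^+ 2)%R.

Let proot_gap g : measurable_fun setT g -> pos_measurable (fun z => (root_gap g z)%:E).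
Proof.
move=> mg; apply: pos_measurable_EFin => [|z]; last exact: sqr_ge0.
have ms := measurable_sqrt_comp mg.
apply: measurable_funX; apply: measurable_funB.
  exact: (measurableT_comp ms measurable_snd).
exact: (measurableT_comp ms measurable_fst).
Qed.

Lemma InuE mu f : density nu mu f -> Inu m nu mu =
  \int[G]_z ((Num.sqrt (f z.2) - Num.sqrt (f z.1)) ^+ 2)%:E.
Proof.
move=> df; rewrite /Inu; case: pselect => [H|[]]; last by exists f.
case: (cid H) => g dg /=; rewrite /Hm muleA -EFinM divff// mul1e.
have [[mf _ _] [mg _ _]] := (df, dg).
rewrite -(GE (proot_gap mg)); apply: ge0_ae_eq_integral => //.
- exact: (proot_gap mg).1.
- exact: (proot_gap mf).1.
- by move=> z _; exact: (proot_gap mg).2.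
- by move=> z _; exact: (proot_gap mf).2.
have gf := density_unique dg df.
have ae1 := joint_ae_fst gf; have ae2 := joint_ae_snd gf.
by apply: filterS2 ae1 ae2 => z /= e1 e2 _; rewrite /root_gap e1 e2.
Qed.

(** [(sqrt q - sqrt p)^2 <= p + q], and [f] has mass 1 under both marginals of [G]. Through the
    hypothesis, this bounds W1 uniformly over all densities, so W1 is finite. *)
Lemma Inu_le2 mu f : density nu mu f -> Inu m nu mu <= 2%:E.
Proof.
move=> df; rewrite (InuE df); have [mf f0 _] := df.
have pf := pos_measurable_EFin mf f0.
have pf1 : pos_measurable (fun z : X * X => (f z.1)%:E).
  by apply: pos_measurable_comp pf _.
have pf2 : pos_measurable (fun z : X * X => (f z.2)%:E).
  by apply: pos_measurable_comp pf _.
have mass1 : \int[G]_z (f z.1)%:E = 1.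
  rewrite (GE pf1) -(density_mass df); apply: eq_integral => x _.
  by rewrite /= integral_cst// prob_kernel mule1.
have mass2 : \int[G]_z (f z.2)%:E = 1 by rewrite -(joint_swap GE rev pf2).
apply: (@le_trans _ _ (\int[G]_z ((f z.1)%:E + (f z.2)%:E))); last first.
  by rewrite pos_intD// mass1 mass2 -EFinD.
apply: pos_le_int => [||z]; [exact: proot_gap|exact: pos_measurableD|].
rewrite -EFinD lee_fin -{2}(sqr_sqrtr (f0 z.1)) -{2}(sqr_sqrtr (f0 z.2)).
have := mulr_ge0 (sqrtr_ge0 (f z.1)) (sqrtr_ge0 (f z.2)).
set p := Num.sqrt (f z.1); set q := Num.sqrt (f z.2) => pq; lra.
Qed.

Lemma Inu_sqrt_energy (mu : probability X R) (f : X -> R) (a b : R) :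
  measurable_fun setT f -> (forall x, (a <= f x <= b)%R) ->
  density nu mu f ->
  Inu m nu mu = (sqrt_energy G f)%:E.
Proof.
move=> mf fab df; rewrite (InuE df) -bdd_EFin//; apply: bddX.
by apply: bddB; apply: bdd_comp (bdd_sqrt mf fab) _.
Qed.

End energy.

(** * Densities bounded away from zero and infinity *)

Section bounded_density.
Set Implicit Arguments.
Unset Strict Implicit.
Local Open Scope ring_scope.
Context {R : realType} {d : measure_display} {X : measurableType d}.
Variable dist : X -> X -> R.
Hypothesis polish : polish_metric dist.
Hypothesis borel : borel_of_metric dist.
Variables (m : R.-pker X ~> X) (nu : probability X R).
Variable G : probability (X * X)%type R.
Hypothesis GE : forall f, pos_measurable f ->
  (\int[G]_z f z = \int[nu]_x \int[m x]_y f (x, y))%E.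
Hypothesis rev : reversible_measure m nu.
Variable th : R.
Hypothesis thE : {ae nu, forall x,
  (\int[m x]_y ((dist x y) ^+ 2)%:E <= (2 * th)%:E)%E}.
Variable K : R.
Hypothesis K0 : 0 < K.
Hypothesis W1_Inu : forall mu : probability X R, mu `<< nu ->
  (W1 dist mu nu <= (K^-1)%:E * sqrte (Inu m nu mu))%E.
Implicit Types (f : X -> R) (mu : probability X R).

Let C := Num.sqrt (2 * th) / K.

Let th0 : 0 <= th. Proof. exact: theta_ge0 thE. Qed.

Let C0 : 0 <= C. Proof. by rewrite divr_ge0 ?sqrtr_ge0// ltW. Qed.

Let w mu := fine (W1 dist mu nu).

Lemma W1_density_le mu f : density nu mu f ->
  (W1 dist mu nu <= (K^-1 * Num.sqrt 2)%:E)%E.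
Proof.
move=> df; apply: le_trans (W1_Inu (density_dominates df)) _.
rewrite EFinM; apply: lee_wpmul2l; first by rewrite lee_fin invr_ge0 ltW.
by have := Inu_le2 GE rev df; rewrite -lee_sqrt ?lee_fin.
Qed.

Let W1_fin mu f : density nu mu f -> W1 dist mu nu \is a fin_num.
Proof.
move=> df; rewrite ge0_fin_numE ?(W1_ge0 polish)//.
by apply: le_lt_trans (W1_density_le df) _; rewrite ltry.
Qed.

Let w_ge0 mu : 0 <= w mu.
Proof. by apply: fine_ge0; exact: W1_ge0 polish _ _. Qed.

Section admissible.
Variables (a b : R).
Hypothesis a0 : 0 < a.

Let admissible mu f :=
  [/\ measurable_fun setT f, forall x, a <= f x <= b & density nu mu f].

Let mass1 mu f : admissible mu f -> \int[nu]_x f x = 1.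
Proof.
move=> [mf fab df]; have := density_mass df.
by rewrite -bdd_EFin => [[]//|]; exact: bdd_itv mf fab.
Qed.

Let w_le_energy mu f : admissible mu f -> w mu <= Num.sqrt (sqrt_energy G f) / K.
Proof.
move=> [mf fab df]; have := W1_Inu (density_dominates df).
rewrite (Inu_sqrt_energy GE rev mf fab df) -(fineK (W1_fin df)) -EFinM lee_fin.
by rewrite mulrC.
Qed.

Let entropy_ge0 mu f : admissible mu f -> 0 <= entropy nu f.
Proof.
move=> adm; have [mf fab df] := adm; have bf := bdd_itv mf fab.
have <- : \int[nu]_x (f x - 1) = 0.
  by rewrite bdd_intB ?prob_int_cst ?(mass1 adm) ?subrr//; exact: bdd_cst.
apply: bdd_int_le => [||x].
- by apply: bddB => //; exact: bdd_cst.
- by apply: bddM => //; exact: bdd_ln a0 mf fab.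
- by apply: xlnx_ge_sub1; have /andP[? _] := fab x; apply: le_trans (ltW a0) _.
Qed.

Section fixed_step.
Variable e : R.
Hypothesis e0 : 0 < e.
Hypothesis e1 : e < 1.
(** The fraction of the first-order entropy loss that survives the second-order error. *)
Let q := 1 - 2 * e * b / a.
Hypothesis q0 : 0 < q.

(** If W1 decreases, factor the difference of squares: [w mu - w mu'] is at most the transport cost,
    [w mu + w mu'] at most twice the bound from the hypothesis, and the product is [2 e C] times the
    energy. *)
Let step mu f : admissible mu f -> exists2 mu', admissible mu' (heat m e f) &
  w mu ^+ 2 <= w mu' ^+ 2 + C / q * (entropy nu f - entropy nu (heat m e f)).
Proof.
move=> adm; have [mf fab df] := adm.
have mh := measurable_heat m e mf fab.
have hab := heat_itv m mf fab e0 e1.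
have [mu' dmu'] : exists mu' : probability X R, density nu mu' (heat m e f).
  apply: density_exists => // [x|].
    by have /andP[? _] := hab x; apply: le_trans (ltW a0) _.
  rewrite -bdd_EFin; last exact: bdd_itv mh hab.
  by rewrite (heat_mass GE rev e mf fab) (mass1 adm).
have adm' : admissible mu' (heat m e f) by split.
exists mu' => //.
have ent := entropy_step GE rev a0 mf fab e0 e1.
have := W1_heat_step polish borel GE rev thE a0 mf fab (mass1 adm) e0 e1 df dmu'.
rewrite -(fineK (W1_fin df)) -(fineK (W1_fin dmu')) -EFinD lee_fin.
rewrite -/(w mu) -/(w mu') => tri.
have wJ := w_le_energy adm.
set J := sqrt_energy G f in tri wJ ent *.
have J0 : 0 <= J by exact: sqrt_energy_ge0.
have CJ : 2 * e * C * J <= C / q * (entropy nu f - entropy nu (heat m e f)).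
  have -> : 2 * e * C * J = C / q * (2 * e * J * q) by field; exact: lt0r_neq0.
  apply: ler_wpM2l; first by rewrite divr_ge0// ltW.
  by move: ent; rewrite -/q; lra.
apply: (@le_trans _ _ (w mu' ^+ 2 + 2 * e * C * J)); last by rewrite lerD2l.
have [ww'|w'w] := leP (w mu) (w mu').
  apply: (@le_trans _ _ (w mu' ^+ 2)).
    by rewrite ler_pXn2r ?nnegrE.
  rewrite lerDl; apply: mulr_ge0 => //; apply: mulr_ge0 => //.
  by apply: mulr_ge0 => //; exact: ltW.
have -> : 2 * e * C * J = e * Num.sqrt (2 * th * J) * (2 * (Num.sqrt J / K)).
  rewrite (@sqrtrM _ (2 * th)) ?mulr_ge0// -{1}(sqr_sqrtr J0) /C; ring.
have d1 : w mu - w mu' <= e * Num.sqrt (2 * th * J) by lra.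
(* In this case [w mu' < w mu], so the bound [sqrt J / K] on [w mu] serves for both terms. *)
have d2 : w mu + w mu' <= 2 * (Num.sqrt J / K) by lra.
have := @ler_pM _ _ _ _ _ _ _ d1 d2.
rewrite subr_ge0 (ltW w'w) addr_ge0// => /(_ isT isT).
have -> : (w mu - w mu') * (w mu + w mu') = w mu ^+ 2 - w mu' ^+ 2 by ring.
lra.
Qed.

(* If the bound fails, each of the [N] first steps loses a fixed amount of entropy. *)
Let alternative N mu f (eta : R) : 0 < eta -> admissible mu f ->
  w mu ^+ 2 <= C / q * entropy nu f + eta \/
  N%:R * (2 * e * q * (K ^+ 2 * eta)) <= entropy nu f.
Proof.
move=> eta0; elim: N mu f => [|N IH] mu f adm.
  by right; rewrite mul0r; exact: entropy_ge0 adm.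
have ent0 := entropy_ge0 adm.
have Cq0 : 0 <= C / q by rewrite divr_ge0// ltW.
have [mu' adm' wstep] := step adm.
have J0 : 0 <= sqrt_energy G f by exact: sqrt_energy_ge0.
(* At an energy of at most [K^2 eta], the hypothesis gives [w mu ^+ 2 <= eta] at once; above it, the
   entropy drops by at least the fixed amount [2 e q (K^2 eta)]. *)
have [Jle|Jgt] := leP (sqrt_energy G f) (K ^+ 2 * eta).
  left; apply: (@le_trans _ _ eta); last by rewrite lerDr mulr_ge0.
  apply: (@le_trans _ _ ((Num.sqrt (sqrt_energy G f) / K) ^+ 2)).
    rewrite ler_pXn2r ?nnegrE ?(w_le_energy adm)//.
    by rewrite divr_ge0 ?sqrtr_ge0// ltW.
  by rewrite expr_div_n sqr_sqrtr// ler_pdivrMr ?exprn_gt0// mulrC.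
have [mf fab df] := adm.
have ent := entropy_step GE rev a0 mf fab e0 e1.
have := IH _ _ adm' => -[h|h]; [left|right].
  by move: h wstep; rewrite mulrBr; lra.
rewrite -natr1 mulrDl mul1r.
have : 2 * e * q * (K ^+ 2 * eta) <= 2 * e * q * sqrt_energy G f.
  by apply: ler_wpM2l; [rewrite !mulr_ge0// ltW|exact: ltW].
by move: ent h; rewrite -/q; lra.
Qed.

Lemma W1_sqr_le_fixed_step mu f : admissible mu f ->
  w mu ^+ 2 <= C / q * entropy nu f.
Proof.
move=> adm; apply/ler_addgt0Pr => eta eta0.
have D0 : 0 < 2 * e * q * (K ^+ 2 * eta).
  by rewrite !mulr_gt0// exprn_gt0.
(* So many steps, plus one, would use up more entropy than is available, which rules out the second
   alternative. *)
pose N := Num.truncn (entropy nu f / (2 * e * q * (K ^+ 2 * eta))).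
have [//|] := alternative N.+1 eta0 adm.
rewrite -ler_pdivlMr// => h.
have := truncnS_gt (entropy nu f / (2 * e * q * (K ^+ 2 * eta))).
by rewrite ltNge h.
Qed.

End fixed_step.

Lemma W1_bounded_density mu f :
  measurable_fun setT f -> (forall x, a <= f x <= b) -> density nu mu f ->
  (W1 dist mu nu <= (Num.sqrt (C * entropy nu f))%:E)%E.
Proof.
move=> mf fab df; have adm : admissible mu f by split.
have ent0 := entropy_ge0 adm.
have b0 : 0 < b.
  by have /andP[af fb] := fab point; exact: lt_le_trans a0 (le_trans af fb).
suff wle : w mu ^+ 2 <= C * entropy nu f.
  rewrite -(fineK (W1_fin df)) lee_fin -/(w mu).
  by rewrite -(ger0_norm (w_ge0 mu)) -sqrtr_sqr ler_wsqrtr.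
apply/ler_addgt0Pr => eta eta0.
pose s := w mu ^+ 2 + 1.
have s0 : 0 < s by rewrite ltr_wpDl ?sqr_ge0.
(* Chosen so that [1 - q = 2 e b / a] is at most 1/2, whence [q > 0], and at most [eta / s], whence
   [w mu ^+ 2 * (1 - q) <= eta]. The 1 in [s] guards against division by zero. *)
pose e := Num.min (2^-1) (a / (2 * b) * Num.min (2^-1) (eta / s)).
have b20 : 0 < 2 * b by rewrite mulr_gt0.
have e0 : 0 < e.
  rewrite lt_min invr_gt0 ltr0n/= mulr_gt0 ?divr_gt0//.
  by rewrite lt_min invr_gt0 ltr0n/= divr_gt0.
have e1 : e < 1 by rewrite gt_min; apply/orP; left; lra.
have ele : 2 * e * b / a <= Num.min (2^-1) (eta / s).
  have : e <= a / (2 * b) * Num.min (2^-1) (eta / s) by rewrite ge_min lexx orbT.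
  rewrite mulrAC ler_pdivlMr// => h.
  rewrite ler_pdivrMr//; move: h; set M := Num.min _ _; lra.
have ele1 : 2 * e * b / a <= 2^-1 by apply: le_trans ele _; rewrite ge_min lexx.
have ele2 : 2 * e * b / a <= eta / s by apply: le_trans ele _; rewrite ge_min lexx orbT.
have q0 : 0 < 1 - 2 * e * b / a by lra.
have := W1_sqr_le_fixed_step e0 e1 q0 adm.
rewrite mulrAC ler_pdivlMr// => h.
have : w mu ^+ 2 * (2 * e * b / a) <= eta.
  apply: (@le_trans _ _ (s * (eta / s))); last by rewrite mulrC divfK ?lt0r_neq0.
  apply: ler_pM => //; [exact: sqr_ge0| |by rewrite /s; lra].
  by rewrite divr_ge0 ?mulr_ge0// ltW.
by move: h; rewrite mulrBr mulr1; lra.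
Qed.

End admissible.
End bounded_density.

(** * General densities *)

Section constant_kernel.
Set Implicit Arguments.
Unset Strict Implicit.
Context d d' (T : measurableType d) (U : measurableType d') (R : realType)
  (P : probability U R).

(** Lets [W1_glue] also treat the mixing with the uniform density, where the destination is drawn
    independently of the starting point. *)
Definition kcst (_ : T) : {measure set U -> \bar R} := P.

Let measurable_kcst A : measurable A -> measurable_fun setT (kcst ^~ A).
Proof. by move=> mA; exact: measurable_cst. Qed.

HB.instance Definition _ := isKernel.Build _ _ _ _ _ kcst measurable_kcst.

Let kcst_prob x : kcst x setT = 1.
Proof. exact: probability_setT. Qed.

HB.instance Definition _ := Kernel_isProbability.Build _ _ _ _ _ kcst kcst_prob.

End constant_kernel.

Section truncation.
Set Implicit Arguments.
Unset Strict Implicit.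
Local Open Scope ring_scope.
Context {R : realType} {d : measure_display} {X : measurableType d}.
Variable dist : X -> X -> R.
Hypothesis polish : polish_metric dist.
Hypothesis borel : borel_of_metric dist.
Variable nu : probability X R.

(** Triangle inequality through the second point of a coupling; with the uniform bound on W1, it
    bounds the first moments of all densities at once. *)
Lemma first_moment_le (mu : probability X R) (x0 : X) :
  (\int[nu]_x (dist x x0)%:E < +oo)%E ->
  (\int[mu]_x (dist x x0)%:E <= W1 dist mu nu + \int[nu]_x (dist x x0)%:E)%E.
Proof.
move=> Doo; have pd := pos_measurable_dist_to polish borel x0.
have D0 : (0 <= \int[nu]_x (dist x x0)%:E)%E by apply: integral_ge0 => x _; exact: pd.2.
rewrite -leeBlDr ?ge0_fin_numE//; apply: le_ereal_inf_tmp => _ [pi cpi <-].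
rewrite leeBlDr ?ge0_fin_numE//.
have pd1 : pos_measurable (fun z : X * X => (dist z.1 x0)%:E).
  by apply: pos_measurable_comp pd _.
have pd2 : pos_measurable (fun z : X * X => (dist z.2 x0)%:E).
  by apply: pos_measurable_comp pd _.
have pdd := pos_measurable_dist polish borel.
rewrite -(coupling_fst cpi pd) -(coupling_snd cpi pd) -pos_intD//.
apply: pos_le_int => // [|z]; first exact: pos_measurableD.
by rewrite -EFinD lee_fin; exact: dist_triangle.
Qed.

Lemma truncation_mass (f : X -> R) (delta : R) :
  measurable_fun setT f -> (forall x, 0 <= f x) ->
  (\int[nu]_x (f x)%:E = 1)%E -> 0 < delta ->
  exists2 n : R, 1 <= n &
    1 - delta <= \int[nu]_x Num.min (f x) n /\ \int[nu]_x Num.min (f x) n <= 1.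
Proof.
move=> mf f0 f1 d0.
(* The shift keeps the truncation level at least 1, as [xlnx_min] requires. *)
pose p (n : nat) x := Num.min (f x) n.+1%:R.
have mp n : measurable_fun setT (p n) by exact: measurable_minr.
have pp n : pos_measurable (fun x => (p n x)%:E).
  by apply: pos_measurable_EFin => // x; rewrite le_min f0/=.
have bp n : bdd_measurable (p n).
  apply: (@bdd_itv _ _ _ _ 0 n.+1%:R) => // x.
  by rewrite le_min f0 ler0n /= ge_min lexx orbT.
have ndp x : nondecreasing_seq (fun n => (p n x)%:E).
  move=> k n kn; rewrite lee_fin /p le_min ge_min lexx /=.
  by rewrite ge_min ler_nat ltnS kn orbT.
have plim : (limn (fun n => \int[nu]_x (p n x)%:E) = 1)%E.
  rewrite -pos_int_lim// -f1; apply: eq_integral => x _.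
  apply/cvg_lim => //; apply: cvg_near_cst.
  near=> n; congr EFin; apply/min_idPl.
  have /(le_trans _) : (Num.truncn (f x)).+1%:R <= n.+1%:R :> R.
    by rewrite ler_nat ltnS; near: n; exact: nbhs_infty_ge.
  by apply; apply: ltW; exact: truncnS_gt.
have le1 n : \int[nu]_x p n x <= 1.
  rewrite -lee_fin bdd_EFin// -f1; apply: pos_le_int => // [|x].
    exact: pos_measurable_EFin.
  by rewrite lee_fin ge_min lexx.
have [n nd] : exists n, ((1 - delta)%:E <= \int[nu]_x (p n x)%:E)%E.
  apply: contrapT => /forallNP H.
  have : (limn (fun n => \int[nu]_x (p n x)%:E) <= (1 - delta)%:E)%E.
    apply: lime_le.
      apply: ereal_nondecreasing_is_cvgn => k n kn; apply: pos_le_int => // x.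
      exact: ndp.
    by apply: nearW => n; apply: ltW; rewrite ltNge; apply/negP; exact: H.
  by rewrite plim lee_fin; lra.
exists n.+1%:R; first by rewrite ler1n.
split; last exact: le1.
by rewrite -lee_fin (bdd_EFin nu (bp n)); exact: nd.
Unshelve. all: by end_near. Qed.

Section mixture.
Variables (f : X -> R) (delta n : R) (mu : probability X R) (x0 : X) (M : R).
Hypothesis df : density nu mu f.
Hypothesis fint : nu.-integrable setT (fun x => (f x * ln (f x))%:E).
Hypothesis delta0 : 0 < delta.
Hypothesis delta1 : delta < 1.
Hypothesis n1 : 1 <= n.
Hypothesis mass_ge : 1 - delta <= \int[nu]_x Num.min (f x) n.
Hypothesis mass_le : \int[nu]_x Num.min (f x) n <= 1.
Hypothesis moment : forall (eta : probability X R) h, density nu eta h ->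
  (\int[eta]_x (dist x x0)%:E <= M%:E)%E.

(* [f] is the sum of [(1 - delta) p] and of the remainder [r], of mass [c]. The
   density [g] keeps the first part and spreads the second one uniformly. *)
Let p x := Num.min (f x) n.
Let c := 1 - (1 - delta) * \int[nu]_x p x.
Let g x := (1 - delta) * p x + c.
Let r x := f x - (1 - delta) * p x.

Let mf : measurable_fun setT f. Proof. by have [] := df. Qed.
Let f0 x : 0 <= f x. Proof. by have [] := df. Qed.
Let n0 : 0 <= n. Proof. exact: le_trans ler01 n1. Qed.
Let p0 x : 0 <= p x. Proof. by rewrite le_min f0 n0. Qed.
Let d'0 : 0 <= 1 - delta. Proof. by rewrite subr_ge0 ltW. Qed.

Let d'1 : 1 - delta <= 1. Proof. by rewrite gerBl ltW. Qed.

(** The factor [1 - delta] secures this even if truncation removes nothing. The lower bound keeps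
    [g] away from 0 and makes [ln (c / delta)] nonnegative. *)
Let c_ge : delta <= c.
Proof.
rewrite /c; have : (1 - delta) * \int[nu]_x p x <= (1 - delta) * 1 by exact: ler_wpM2l.
by rewrite mulr1; lra.
Qed.

(** The mass bound gives [c <= 1 - (1 - delta)^2]. *)
Let c_le : c <= 2 * delta.
Proof.
rewrite /c; have := ler_wpM2l d'0 mass_ge; rewrite -/p.
have := sqr_ge0 delta; rewrite expr2; lra.
Qed.

Let c0 : 0 < c. Proof. exact: lt_le_trans delta0 c_ge. Qed.

Let mp : measurable_fun setT p. Proof. exact: measurable_minr. Qed.

Let p_itv x : 0 <= p x <= n.
Proof. by rewrite p0 ge_min lexx orbT. Qed.

Let bp : bdd_measurable p. Proof. exact: bdd_itv mp p_itv. Qed.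

Let bdp : bdd_measurable (fun x => (1 - delta) * p x).
Proof. by apply: bddM => //; exact: bdd_cst. Qed.

Let bg : bdd_measurable g. Proof. by apply: bddD => //; exact: bdd_cst. Qed.

Let g_itv x : c <= g x <= n + c.
Proof.
rewrite /g lerDr mulr_ge0//= lerD2r.
have /andP[_ pn] := p_itv x; apply: le_trans pn.
by rewrite -[leRHS]mul1r ler_wpM2r.
Qed.

Let g0 x : 0 < g x.
Proof. by have /andP[? _] := g_itv x; exact: lt_le_trans c0 _. Qed.

Let bgV : bdd_measurable (fun x => (g x)^-1).
Proof. exact: bdd_inv c0 bg.1 g_itv. Qed.

Let r0 x : 0 <= r x.
Proof.
rewrite subr_ge0; have pf : p x <= f x by rewrite ge_min lexx.
by apply: le_trans pf; rewrite -[leRHS]mul1r ler_wpM2r.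
Qed.

Let mr : measurable_fun setT r. Proof. exact: measurable_funB mf bdp.1. Qed.

Let pr : pos_measurable (fun x => (r x)%:E). Proof. exact: pos_measurable_EFin. Qed.

Let pdp : pos_measurable (fun x => ((1 - delta) * p x)%:E).
Proof. by apply: pos_measurable_EFin => [|x]; [exact: bdp.1|rewrite mulr_ge0]. Qed.

Let fE x : f x = (1 - delta) * p x + r x.
Proof. by rewrite /r; ring. Qed.

Let r_mass : (\int[nu]_x (r x)%:E = c%:E)%E.
Proof.
have : (\int[nu]_x (((1 - delta) * p x)%:E + (r x)%:E) = 1)%E.
  by rewrite -(density_mass df); apply: eq_integral => x _; rewrite [in RHS]fE EFinD.
rewrite pos_intD// -bdd_EFin// bdd_intZ// => H.
have rfin : (\int[nu]_x (r x)%:E)%E \is a fin_num.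
  rewrite ge0_fin_numE; last by apply: integral_ge0 => x _; exact: pr.2.
  by rewrite ltNge leye_eq; apply/negP => /eqP Hoo; move: H; rewrite Hoo.
by move: H; rewrite -(fineK rfin) -EFinD => -[] H; congr EFin; rewrite /c; lra.
Qed.

Let g_mass : (\int[nu]_x (g x)%:E = 1)%E.
Proof.
rewrite -bdd_EFin// bdd_intD//; last exact: bdd_cst.
by rewrite bdd_intZ// prob_int_cst /c addrC subrK.
Qed.

(** The normalized remainder [r / c] is itself a density, so [moment] applies to it with a bound
    that does not depend on the truncation. *)
Let r_moment : (\int[nu]_x ((r x)%:E * (dist x x0)%:E) <= (c * M)%:E)%E.
Proof.
have pd := pos_measurable_dist_to polish borel x0.
have [eta deta] : exists eta : probability X R, density nu eta (fun x => c^-1 * r x).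
  apply: density_exists => [|x|].
  - exact: measurable_funM.
  - by rewrite mulr_ge0// invr_ge0 ltW.
  - under eq_integral do rewrite EFinM.
    rewrite pos_intZ ?invr_ge0 ?(ltW c0)//.
    by rewrite r_mass -EFinM mulVf ?lt0r_neq0.
have := moment deta; rewrite (density_integral deta pd).
under eq_integral do rewrite EFinM -muleA.
rewrite pos_intZ ?invr_ge0 ?(ltW c0)//; last exact: pos_measurableM.
move=> H; have := lee_wpmul2l (_ : 0 <= c%:E)%E H.
rewrite muleA -EFinM mulfV ?lt0r_neq0// mul1e -EFinM; apply.
by rewrite lee_fin ltW.
Qed.

(** [t ln t] increases on [[1, +oo[], which contains the level [n]. *)
Lemma xlnx_min (t : R) : 0 <= t -> Num.min t n * ln (Num.min t n) <= t * ln t.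
Proof.
move=> t0; have [tn|nt] := leP t n; first by [].
have n0' : 0 < n by exact: lt_le_trans ltr01 n1.
apply: ler_pM => //; [exact: ln_ge0|exact: ltW|].
by rewrite ler_ln ?posrE ?(ltW nt)//; exact: lt_trans nt.
Qed.

(** [xlnx_mix] with [s = delta] bounds the integrand by [(1 - delta) p ln p + c ln (c / delta)].
    Since [delta <= c <= 2 delta], the last logarithm is at most 1. The factor [1 - delta] is
    dropped because the entropy is nonnegative. *)
Lemma entropy_mixture_le :
  entropy nu g <= entropy nu f + 2 * delta.
Proof.
have ent0 : 0 <= entropy nu f.
  have : \int[nu]_x (f x - 1) <= entropy nu f.
    apply: le_Rintegral => //.
    - apply: (@integrableB _ _ _ nu setT measurableT (EFin \o f) (EFin \o cst 1)).
        apply/integrableP; split; first exact/measurable_EFinP.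
        under eq_integral do rewrite /= ger0_norm//.
        by rewrite (density_mass df) ltry.
      by apply: bdd_integrable; exact: bdd_cst.
    - by move=> x _; exact: xlnx_ge_sub1.
  apply: le_trans; rewrite RintegralB//.
  - rewrite prob_int_cst /Rintegral (density_mass df) /= subrr //.
  - apply/integrableP; split; first exact/measurable_EFinP.
    under eq_integral do rewrite /= ger0_norm//.
    by rewrite (density_mass df) ltry.
  - by apply: bdd_integrable; exact: bdd_cst.
have cd1 : 1 <= c / delta by rewrite ler_pdivlMr// mul1r.
have cd2 : c / delta <= 2 by rewrite ler_pdivrMr.
have cln : c * ln (c / delta) <= 2 * delta.
  have l0 : 0 <= ln (c / delta) by exact: ln_ge0.
  have l1 : ln (c / delta) <= 1.
    have := @ln_le_sub1 _ (c / delta) (lt_le_trans ltr01 cd1); lra.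
  by rewrite -[leRHS]mulr1; apply: ler_pM => //; exact: ltW.
apply: (@le_trans _ _ ((1 - delta) * entropy nu f + 2 * delta)); last first.
  by rewrite lerD2r -[leRHS]mul1r ler_wpM2r.
have -> : (1 - delta) * entropy nu f + 2 * delta =
    \int[nu]_x ((1 - delta) * (f x * ln (f x)) + 2 * delta).
  rewrite RintegralD//; last 2 first.
  - by have := @integrableZl _ _ _ nu setT measurableT (1 - delta) _ fint.
  - by apply: bdd_integrable; exact: bdd_cst.
  by rewrite prob_int_cst RintegralZl.
apply: le_Rintegral => //.
- apply: bdd_integrable; apply: bddM => //; exact: bdd_ln c0 bg.1 g_itv.
- apply: (@integrableD _ _ _ nu setT measurableT
    (fun x => ((1 - delta) * (f x * ln (f x)))%:E) (fun x => (2 * delta)%:E)).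
    by have := @integrableZl _ _ _ nu setT measurableT (1 - delta) _ fint.
  by apply: bdd_integrable; exact: bdd_cst.
- move=> x _; apply: le_trans (xlnx_mix delta0 delta1 c0 (p0 x)) _.
  apply: lerD => //; apply: ler_wpM2l => //; exact: xlnx_min.
Qed.

(** The common part [(1 - delta) p] stays in place. The uniform part of mass [c] is moved onto [r],
    independently of its starting point and by way of [x0]: a cost of at most [c M] for each half of
    the trip. *)
Lemma W1_mixture (mu' : probability X R) : density nu mu' g ->
  (W1 dist mu nu <= (2 * delta * (M + M))%:E + W1 dist mu' nu)%E.
Proof.
move=> dg.
pose rho x := (1 - delta) * p x / g x.
pose k (z : X * X) := r z.2 / g z.1.
have brho : bdd_measurable rho by exact: bddM.
have rho0 x : 0 <= rho x by rewrite divr_ge0 ?(ltW (g0 _))// mulr_ge0.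
have mk : measurable_fun setT k.
  apply: measurable_funM; first exact: (measurableT_comp mr measurable_snd).
  exact: (measurableT_comp bgV.1 measurable_fst).
have k0 z : 0 <= k z by rewrite divr_ge0 ?(ltW (g0 _)).
have gV0 y : 0 <= (g y)^-1 by rewrite invr_ge0 ltW.
have kint (h : X -> \bar R) y : pos_measurable h ->
    (\int[kcst nu y]_x ((k (y, x))%:E * h x) =
     (g y)^-1%:E * \int[nu]_x ((r x)%:E * h x))%E.
  move=> ph; rewrite -pos_intZ//; last exact: pos_measurableM.
  by apply: eq_integral => x _; rewrite muleA -EFinM [in RHS]mulrC.
have ker1 y : ((rho y)%:E + \int[kcst nu y]_x (k (y, x))%:E = 1)%E.
  have -> : (\int[kcst nu y]_x (k (y, x))%:E = (g y)^-1%:E * c%:E)%E.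
    rewrite -r_mass -pos_intZ//; apply: eq_integral => x _.
    by rewrite -EFinM [in RHS]mulrC.
  rewrite -EFinM -EFinD; congr EFin.
  by rewrite /rho [X in _ + X]mulrC -mulrDl -/(g y) divff ?lt0r_neq0.
have pgV : pos_measurable (fun x => ((g x)^-1)%:E).
  by apply: pos_measurable_EFin => //; exact: bgV.1.
have pd := pos_measurable_dist_to polish borel.
have law A : measurable A -> (mu A = \int[mu']_y ((rho y)%:E * (\1_A y)%:E
    + \int[kcst nu y]_x ((k (y, x))%:E * (\1_A x)%:E)))%E.
  move=> mA; have pA := @pos_measurable_indic R _ _ _ mA.
  pose S := (\int[nu]_x ((r x)%:E * (\1_A x)%:E))%E.
  have S0 : (0 <= S)%E by apply: integral_ge0 => x _; rewrite -EFinM lee_fin mulr_ge0.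
  under eq_integral do rewrite kint//.
  have prhoA : pos_measurable (fun y => (rho y)%:E * (\1_A y)%:E)%E.
    by apply: pos_measurableM => //; exact: pos_measurable_EFin brho.1 rho0.
  have pgS : pos_measurable (fun y => (g y)^-1%:E * S)%E.
    by apply: pos_measurableM => //; split.
  rewrite (density_integral dg); last exact: pos_measurableD.
  have -> : mu A = (\int[nu]_y ((f y)%:E * (\1_A y)%:E))%E.
    by have [_ _ muE] := df; apply: etrans (muE _ mA) _; rewrite int_mul_indic.
  transitivity (\int[nu]_y ((((1 - delta) * p y)%:E * (\1_A y)%:E) + S))%E.
    rewrite pos_intD; [|exact: pos_measurableM|by split].
    rewrite prob_eint_cst.
    rewrite /S -pos_intD; try exact: pos_measurableM.
    by apply: eq_integral => y _; rewrite fE EFinD ge0_muleDl// lee_fin ?mulr_ge0.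
  apply: eq_integral => y _; rewrite ge0_muleDr; [|exact: prhoA.2|exact: pgS.2].
  rewrite !muleA -!EFinM divff ?lt0r_neq0// mul1e.
  by rewrite /rho [g y * _]mulrC divfK ?lt0r_neq0.
have := W1_glue polish borel nu brho.1 rho0 mk k0 ker1 law.
move=> /le_trans; apply; apply: leeD => //.
have prd : pos_measurable (fun z : X * X => (r z.2)%:E * (dist z.2 z.1)%:E)%E.
  apply: pos_measurableM; first by apply: pos_measurable_comp pr _.
  by under eq_fun do rewrite (dist_sym polish); exact: pos_measurable_dist.
have prdi : pos_measurable (fun y => \int[nu]_x ((r x)%:E * (dist x y)%:E))%E.
  exact: (pos_measurable_kernel (kcst nu) prd).
under eq_integral do rewrite kint//.
rewrite (density_integral dg); last exact: pos_measurableM.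
under eq_integral do rewrite muleA -EFinM divff ?lt0r_neq0// mul1e.
have prx0 : pos_measurable (fun x => (r x)%:E * (dist x x0)%:E)%E.
  exact: pos_measurableM.
have nuM : (\int[nu]_x (dist x x0)%:E <= M%:E)%E.
  (* [nu] has density 1 with respect to itself. *)
  apply: (moment (h := fun=> 1)); split=> // A mA.
  by rewrite integral_cst// mul1e.
have M0 : 0 <= M.
  by rewrite -lee_fin; apply: le_trans nuM; apply: integral_ge0 => x _; exact: (pd x0).2.
apply: (@le_trans _ _ (\int[nu]_y ((c * M)%:E + c%:E * (dist y x0)%:E))%E).
  apply: pos_le_int => // [|y].
    apply: pos_measurableD; first by split=> // x; rewrite lee_fin mulr_ge0// ltW.
    by apply: pos_measurableM => //; split=> // x; rewrite lee_fin ltW.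
  apply: (@le_trans _ _ (\int[nu]_x ((r x)%:E * (dist x x0)%:E +
      (dist y x0)%:E * (r x)%:E))%E).
    apply: pos_le_int => [||x].
    - exact: pos_measurableM.
    - apply: pos_measurableD => //; apply: pos_measurableM => //.
      by split=> // x; rewrite lee_fin dist_ge0.
    - rewrite -!EFinM -EFinD lee_fin [dist y x0 * _]mulrC -mulrDr.
      by apply: ler_wpM2l => //; rewrite (dist_sym polish y); exact: dist_triangle.
  rewrite pos_intD//; last first.
    by apply: pos_measurableM => //; split=> // x; rewrite lee_fin dist_ge0.
  rewrite pos_intZ ?dist_ge0// r_mass; apply: leeD; first exact: r_moment.
  by rewrite muleC.
rewrite pos_intD; last 2 first.
- by split=> // x; rewrite lee_fin mulr_ge0// ltW.
- by apply: pos_measurableM => //; split=> // x; rewrite lee_fin ltW.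
rewrite prob_eint_cst.
rewrite pos_intZ ?(ltW c0)//.
apply: (@le_trans _ _ ((c * M)%:E + c%:E * M%:E)%E).
  by apply: leeD => //; apply: lee_wpmul2l => //; rewrite lee_fin ltW.
rewrite -EFinM -EFinD lee_fin -mulrDr; apply: ler_wpM2r => //.
by rewrite addr_ge0.
Qed.

Lemma mixture_approx : exists (mu' : probability X R) (h : X -> R) (a b : R),
  [/\ 0 < a, measurable_fun setT h, forall x, a <= h x <= b & density nu mu' h] /\
  entropy nu h <= entropy nu f + 2 * delta /\
  (W1 dist mu nu <= (2 * delta * (M + M))%:E + W1 dist mu' nu)%E.
Proof.
have [mu' dg] : exists mu' : probability X R, density nu mu' g.
  by apply: density_exists => // [|x]; [exact: bg.1|exact: ltW].
exists mu', g, c, (n + c); split; [split=> //; exact: bg.1|split].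
- exact: entropy_mixture_le.
- exact: W1_mixture.
Qed.

End mixture.
End truncation.

(** * Removing the truncation *)

Section transport_entropy.
Set Implicit Arguments.
Unset Strict Implicit.
Local Open Scope ring_scope.
Context {R : realType} {d : measure_display} {X : measurableType d}.
Variable dist : X -> X -> R.
Hypothesis polish : polish_metric dist.
Hypothesis borel : borel_of_metric dist.
Variables (m : R.-pker X ~> X) (nu : probability X R).
Variable G : probability (X * X)%type R.
Hypothesis GE : forall f, pos_measurable f ->
  (\int[G]_z f z = \int[nu]_x \int[m x]_y f (x, y))%E.
Hypothesis rev : reversible_measure m nu.
Variable th : R.
Hypothesis thE : {ae nu, forall x,
  (\int[m x]_y ((dist x y) ^+ 2)%:E <= (2 * th)%:E)%E}.
Variable K : R.
Hypothesis K0 : 0 < K.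
Hypothesis W1_Inu : forall mu : probability X R, mu `<< nu ->
  (W1 dist mu nu <= (K^-1)%:E * sqrte (Inu m nu mu))%E.

Lemma W1_density (mu : probability X R) (f : X -> R) (x0 : X) :
  (\int[nu]_x (dist x x0)%:E < +oo)%E ->
  density nu mu f -> nu.-integrable setT (fun x => (f x * ln (f x))%:E) ->
  (W1 dist mu nu <= (Num.sqrt (Num.sqrt (2 * th) / K * entropy nu f))%:E)%E.
Proof.
move=> Doo df fint; have [mf f0 _] := df.
have D0 : (0 <= \int[nu]_x (dist x x0)%:E)%E.
  by apply: integral_ge0 => x _; rewrite lee_fin dist_ge0.
have Dfin : (\int[nu]_x (dist x x0)%:E)%E \is a fin_num by rewrite ge0_fin_numE.
set C := Num.sqrt (2 * th) / K.
have C0 : 0 <= C by rewrite divr_ge0 ?sqrtr_ge0// ltW.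
pose M := K^-1 * Num.sqrt 2 + fine (\int[nu]_x (dist x x0)%:E)%E.
have M0 : 0 <= M.
  by rewrite addr_ge0 ?fine_ge0// mulr_ge0 ?sqrtr_ge0// invr_ge0 ltW.
have moment (eta : probability X R) h : density nu eta h ->
    (\int[eta]_x (dist x x0)%:E <= M%:E)%E.
  move=> deta; apply: le_trans (first_moment_le polish borel eta Doo) _.
  rewrite EFinD fineK//; apply: leeD => //.
  exact: (W1_density_le GE rev K0 W1_Inu deta).
have approx (delta : R) : 0 < delta -> delta < 1 ->
    (W1 dist mu nu <= (2 * delta * (M + M) +
      Num.sqrt (C * (entropy nu f + 2 * delta)))%:E)%E.
  move=> d0 d1.
  have [n n1 [ge1 le1]] := truncation_mass mf f0 (density_mass df) d0.
  have [mu' [h [a [b [[a0 mh hab dh] [ent Wle]]]]]] :=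
    mixture_approx polish borel df fint d0 d1 n1 ge1 le1 moment.
  apply: le_trans Wle _; rewrite EFinD; apply: leeD => //.
  apply: le_trans (W1_bounded_density polish borel GE rev thE K0 W1_Inu a0 mh hab dh) _.
  by rewrite lee_fin ler_wsqrtr// ler_wpM2l.
set S := Num.sqrt (C * entropy nu f).
apply/lee_addgt0Pr => eps eps0; rewrite -EFinD.
(* The 8s give [4 delta M <= eps / 2] for the moved mass and [2 C delta <= (eps / 2)^2] under the
   root, where [sqrt (S^2 + (eps / 2)^2) <= S + eps / 2]. *)
pose delta := Num.min (2^-1) (Num.min (eps / (8 * (M + 1))) (eps ^+ 2 / (8 * (C + 1)))).
have M1 : 0 < 8 * (M + 1) by lra.
have C1 : 0 < 8 * (C + 1) by lra.
have d0 : 0 < delta.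
  by rewrite !lt_min invr_gt0 ltr0n/= !divr_gt0// exprn_gt0.
have d1 : delta < 1 by rewrite gt_min; apply/orP; left; lra.
have dM : delta * (8 * (M + 1)) <= eps.
  by rewrite -ler_pdivlMr// /delta !ge_min lexx !orbT.
have dC : delta * (8 * (C + 1)) <= eps ^+ 2.
  by rewrite -ler_pdivlMr// /delta !ge_min lexx !orbT.
apply: le_trans (approx delta d0 d1) _; rewrite lee_fin addrC.
apply: (@le_trans _ _ (Num.sqrt ((S + eps / 2) ^+ 2) + eps / 2)).
  apply: lerD; last lra.
  apply: ler_wsqrtr; rewrite mulrDr.
  have S0 : 0 <= S by exact: sqrtr_ge0.
  apply: (@le_trans _ _ (S ^+ 2 + (eps / 2) ^+ 2)).
    apply: lerD; last by rewrite expr_div_n; lra.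
    (* A negative product, whose root is 0 by convention, is below [S^2] anyway; so the sign of the
       entropy need not be settled here. *)
    have [CE|CE] := leP 0 (C * entropy nu f); first by rewrite sqr_sqrtr.
    by apply: le_trans (ltW CE) _; exact: sqr_ge0.
  rewrite sqrrD -[leLHS]addr0 -addrA [X in _ <= X]addrAC -addrA.
  have : 0 <= S * (eps / 2) by rewrite mulr_ge0// divr_ge0// ltW.
  lra.
rewrite sqrtr_sqr ger0_norm; last by rewrite addr_ge0 ?sqrtr_ge0// divr_ge0// ltW.
lra.
Qed.

End transport_entropy.

(** Finite entropy is covered by [W1_density]. Infinite entropy makes the right side infinite,
    except when Theta is 0: the product with [+oo] is then 0, and W1 must be shown to vanish. *)
Theorem theorem3p25 (R : realType) (d : measure_display) (X : measurableType d)
  (dist : X -> X -> R) (m : R.-pker X ~> X) (nu : probability X R) (K : R) :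
  polish_metric dist ->
  borel_of_metric dist ->
  (forall x : X, \int[m x]_y (dist x y)%:E < +oo) ->
  invariant_measure m nu ->
  reversible_measure m nu ->
  Theta dist m nu < +oo ->
  (exists x0, \int[nu]_x (dist x x0)%:E < +oo) ->
  (0 < K)%R ->
  (forall mu : probability X R, mu `<< nu ->
     W1 dist mu nu <= (K^-1)%:E * sqrte (Inu m nu mu)) ->
  forall mu : probability X R, mu `<< nu ->
    W1 dist mu nu <=
      sqrte ((Num.sqrt (2 * fine (Theta dist m nu)) / K)%:E * Ent nu mu).
Proof.
move=> polish borel _ _ rev Theta_fin [x0 x0_fin] K0 W1_Inu mu munu.
have [G GE] := kernel_joint nu m.
have sq_ge0 x : 0 <= (2^-1)%:E * \int[m x]_y ((dist x y) ^+ 2)%:E.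
  apply: mule_ge0; first by rewrite lee_fin invr_ge0.
  by apply: integral_ge0 => y _; rewrite lee_fin sqr_ge0.
have Theta_num : Theta dist m nu \is a fin_num.
  rewrite ge0_fin_numE//; apply: ess_sup_gee; last exact: nearW.
  by rewrite (_ : 0 < _ = (0 < 1 :> \bar R))// -(@probability_setT _ _ _ nu).
set th := fine (Theta dist m nu).
have thE : {ae nu, forall x, \int[m x]_y ((dist x y) ^+ 2)%:E <= (2 * th)%:E}.
  have := @ess_sup_ge _ _ _ nu (fun x => (2^-1)%:E * \int[m x]_y ((dist x y) ^+ 2)%:E).
  apply: filterS => x; rewrite -/(Theta dist m nu) -(fineK Theta_num) -/th => h.
  have two0 : (0 : \bar R) <= 2%:E by rewrite lee_fin.
  have := lee_wpmul2l two0 h.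
  by rewrite muleA -!EFinM divff// mul1e.
have pdist2 : pos_measurable (fun z : X * X => ((dist z.1 z.2) ^+ 2)%:E).
  apply: pos_measurable_EFin => [|z]; last exact: sqr_ge0.
  by apply: measurable_funX; exact: measurable_dist.
have [f0 df0] := dominated_density munu.
rewrite /Ent; case: pselect => [H|[]]; last by exists f0.
case: (cid H) => f df /=; case: pselect => fint.
  rewrite (density_mass df) /= ln1 mulr0 sube0.
  have := W1_density polish borel GE rev thE K0 W1_Inu x0_fin df fint.
  rewrite /entropy /Rintegral -[in X in _ -> _ <= sqrte (_ * X)](@fineK _ (\int[nu]_x _)).
    by rewrite -EFinM.
  exact: integrable_fin_num.
have th0 := theta_ge0 thE.
move: th0; rewrite le_eqVlt => /predU1P[th0|th0]; last first.
  by rewrite gt0_muley ?leey// lte_fin divr_gt0// sqrtr_gt0 mulr_gt0.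
rewrite -th0 mulr0 sqrtr0 mul0r mul0e sqrte0.
apply: le_trans (W1_Inu _ munu) _; rewrite (InuE GE rev df).
(* With Theta equal to 0 the walk almost surely does not move: [G] is concentrated on the diagonal,
   the energy of any density is 0, and the hypothesis forces W1 to be 0. *)
have d2_0 : \int[G]_z ((dist z.1 z.2) ^+ 2)%:E = 0.
  apply/eqP; rewrite eq_le; apply/andP; split; last first.
    by apply: integral_ge0 => z _; exact: pdist2.2.
  rewrite (GE _ pdist2) -(@integral0 _ _ _ nu setT).
  apply: ae_ge0_le_integral => //.
  - by move=> x _; apply: integral_ge0 => y _; exact: (pdist2.2 (x, y)).
  - exact: (pos_measurable_kernel m pdist2).1.
  - by apply: filterS thE => x /= h _; move: h; rewrite -th0 mulr0.
have ae_diag : {ae G, forall z, z.1 = z.2}.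
  have /(ae_eq_integral_abs G measurableT pdist2.1) :
      \int[G]_z `|((dist z.1 z.2) ^+ 2)%:E| = 0.
    by rewrite -[RHS]d2_0; apply: eq_integral => z _; rewrite gee0_abs// lee_fin sqr_ge0.
  apply: filterS => z /(_ Logic.I) /= [] /eqP.
  by rewrite sqrf_eq0 => /eqP; rewrite (dist_eq0 polish).
have [mf f_ge0 _] := df; have ms := measurable_sqrt_comp mf.
suff -> : \int[G]_z ((Num.sqrt (f z.2) - Num.sqrt (f z.1)) ^+ 2)%:E = 0.
  by rewrite sqrte0 mule0.
rewrite -(@integral0 _ _ _ G setT); apply: ge0_ae_eq_integral => //.
- apply/measurable_EFinP; apply: measurable_funX; apply: measurable_funB.
    exact: (measurableT_comp ms measurable_snd).
  exact: (measurableT_comp ms measurable_fst).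
- by move=> z _; rewrite lee_fin sqr_ge0.
- by apply: filterS ae_diag => z -> _; rewrite subrr expr0n.
Qed.
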